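(* Let $\mathcal{D}\subset\mathbb{R}^N$ be open, bounded, connected, let $F:\partial\mathcal{D}\to\mathbb{R}$ be continuous, and for $\epsilon\in(0,1)$ define $u^\epsilon:\mathcal{D}\to\mathbb{R}$ by $u^\epsilon(x_0)=\mathbb{E}[F\circ X^{\epsilon,x_0}]=\int_\Omega F\circ X^{\epsilon,x_0}\,d\mathbb{P}$. Then $u^\epsilon$ is continuous and satisfies $$u^\epsilon(x)=\frac{1}{|B_{\epsilon\wedge\operatorname{dist}(x,\partial\mathcal{D})}(x)|}\int_{B_{\epsilon\wedge\operatorname{dist}(x,\partial\mathcal{D})}(x)}u^\epsilon(y)\,dy\quad\text{for all }x\in\mathcal{D}.$$
   Context: Probability space: $\Omega_1=B_1(0)\subset\mathbb{R}^N$ with Borel $\sigma$-algebra and normalised Lebesgue measure $\mathbb{P}_1$; $(\Omega,\mathcal{F},\mathbb{P})$ is the countable product $\Omega=(\Omega_1)^{\mathbb{N}}$, $\omega=\{w_i\}_{i\ge1}$, with $\mathcal{F}_n$ the $\sigma$-algebra generated by the first $n$ coordinates. The $\epsilon$-ball walk started at $x_0\in\mathcal{D}$: $X_0^{\epsilon,x_0}\equiv x_0$, $X_n^{\epsilon,x_0}=X_{n-1}^{\epsilon,x_0}+\big(\epsilon\wedge\operatorname{dist}(X_{n-1}^{\epsilon,x_0},\partial\mathcal{D})\big)w_n$ for $n\ge1$. This sequence converges $\mathbb{P}$-a.s. to a random variable $X^{\epsilon,x_0}:\Omega\to\partial\mathcal{D}$, and $X^{\epsilon,x_0}$ denotes this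 limit. *)

(* Defs.v *)
From HB Require Import structures.
From mathcomp Require Import all_boot all_order all_algebra.
From mathcomp Require Import all_classical all_reals all_analysis.
Unset Printing Implicit Defensive.
Import Order.TTheory GRing.Theory Num.Theory.
Import numFieldNormedType.Exports.
Local Open Scope classical_set_scope.
Local Open Scope ring_scope.

(** Points of R^N are row vectors 'rV[R]_N.  The library norm on 'rV is the
    sup-norm, so the Euclidean structure is defined explicitly here.
    (Topological notions -- open, connected, closure, continuity, limits --
    do not depend on the choice of norm.) *)
Definition euc_norm {R : realType} {N : nat} (x : 'rV[R]_N) : R :=
  Num.sqrt (\sum_(i < N) x ord0 i ^+ 2).

Definition euc_ball {R : realType} {N : nat} (x : 'rV[R]_N) (r : R) : set 'rV[R]_N :=
  [set y | euc_norm (y - x) < r].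

Definition bdry {R : realType} {N : nat} (D : set 'rV[R]_N) : set 'rV[R]_N :=
  closure D `\` interior D.

Definition euc_dist {R : realType} {N : nat} (x : 'rV[R]_N) (A : set 'rV[R]_N) : R :=
  inf [set euc_norm (x - y) | y in A].

(** The Borel sigma-algebra on R^N: generated by the coordinate maps
    (product of the Borel sigma-algebras of R). *)
Definition coord_sets (R : realType) (N : nat) : set (set 'rV[R]_N) :=
  [set A | exists (i : 'I_N) (B : set R), measurable B /\
           A = (fun x : 'rV[R]_N => x ord0 i) @^-1` B].

Definition RN (R : realType) (N : nat) := g_sigma_algebraType (coord_sets R N).

(** Lebesgue measure on R^N is characterised (uniquely, on Borel sets) by its
    value on half-open boxes. *)
Definition is_lebesgue_RN {R : realType} {N : nat}
    (lam : {measure set (RN R N) -> \bar R}) : Prop :=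
  forall a b : 'rV[R]_N, (forall i, a ord0 i <= b ord0 i) ->
    lam [set x : RN R N | forall i, a ord0 i < x ord0 i <= b ord0 i]
    = (\prod_(i < N) (b ord0 i - a ord0 i))%:E.

Definition cyl_sets (R : realType) (N : nat) : set (set (nat -> 'rV[R]_N)) :=
  [set C | exists (i : nat) (A : set (RN R N)), measurable A /\
           C = (fun w : nat -> 'rV[R]_N => w i) @^-1` A].

Definition Omega (R : realType) (N : nat) := g_sigma_algebraType (cyl_sets R N).

(** P is the countable product of the normalised Lebesgue measure on the unit
    ball B_1(0): it is characterised (uniquely) by its values on cylinders. *)
Definition is_ball_product {R : realType} {N : nat}
    (lam : {measure set (RN R N) -> \bar R}) (P : probability (Omega R N) R) : Prop :=
  forall (n : nat) (A : nat -> set (RN R N)), (forall i, measurable (A i)) ->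
    P [set w : Omega R N | forall i, (i < n)%N -> A i (w i)]
    = (\prod_(i < n) (fine (lam (A i `&` euc_ball 0 1)) / fine (lam (euc_ball 0 1))))%:E.

(** The epsilon-ball walk: X_0 = x0,
    X_{n+1} = X_n + (eps /\ dist(X_n, bdry D)) w_{n+1};
    here w_{n+1} is the coordinate w n of w : nat -> R^N. *)
Fixpoint ball_walk {R : realType} {N : nat} (D : set 'rV[R]_N) (eps : R)
    (x0 : 'rV[R]_N) (w : nat -> 'rV[R]_N) (n : nat) : 'rV[R]_N :=
  match n with
  | 0 => x0
  | m.+1 => let X := ball_walk D eps x0 w m in
            X + (Num.min eps (euc_dist X (bdry D))) *: w m
  end.

(** X^{eps,x0} : the limit of the walk (a.s. defined). *)
Definition walk_limit {R : realType} {N : nat} (D : set 'rV[R]_N) (eps : R)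
    (x0 : 'rV[R]_N) (w : nat -> 'rV[R]_N) : 'rV[R]_N :=
  lim (ball_walk D eps x0 w @ \oo).

Definition u_eps {R : realType} {N : nat} (P : probability (Omega R N) R)
    (D : set 'rV[R]_N) (F : 'rV[R]_N -> R) (eps : R) (x0 : 'rV[R]_N) : R :=
  fine (\int[P]_(w in [set: Omega R N]) (F (walk_limit D eps x0 w))%:E).

(* Main.v *)
Require Import Defs.
From HB Require Import structures.
From mathcomp Require Import all_boot all_order all_algebra.
From mathcomp Require Import all_classical all_reals all_analysis.
From mathcomp Require Import measurable_realfun ring lra.
Set Implicit Arguments.
Unset Strict Implicit.
Import Order.TTheory GRing.Theory Num.Theory.
Import numFieldNormedType.Exports.
Local Open Scope classical_set_scope.
Local Open Scope ring_scope.

(** The law of [w] is the product of the law of [w 0] and of the law of the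
    shifted sequence, and the walk restarted after one step is driven by the
    shifted sequence.  Hence, once [X] exists almost surely, Fubini turns
    [u x = E (F X^x)] into [u x = E (u (x + r w 0))], which is the mean value
    property.  Continuity follows from it: [u] is bounded and measurable, and
    the ball of averaging varies continuously with [x], so that the average
    changes at most by the volume of a thin spherical shell.

    Almost sure convergence comes from Doob's upcrossing inequality for the
    coordinates of the walk, which are bounded harmonic functions of the current
    point; it is proved by induction on the number of steps, so that only the
    one-step Markov property is needed.  The limit cannot lie in [D], because
    there the step sizes stay bounded below while almost surely [|w n| >= 1/2]
    infinitely often. *)

(** * Euclidean norm and Borel sets *)

(** The integrand in [u_eps] need not be measurable: [F] is arbitrary off the boundary, and [lim]
    takes a default value where the walk diverges. It is replaced by a jointly measurable version,
    the zero extension of [F] from [bdry D] evaluated at the coordinatewise upper limit of the walk.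
    The two agree wherever the walk converges to a boundary point, and the integral ignores null
    sets even for a nonmeasurable integrand. Adding a bound [C] of [|F|] on the boundary makes the
    payoff nonnegative, so that Tonelli needs no integrability check.

    Both measures are known only through their values on boxes and on cylinders, so scaling,
    reflection and independence all come from uniqueness of measures on a pi-system. Reflection is
    what makes the coordinates harmonic: the unit ball is symmetric, hence the linear part of an
    affine function averages to zero. *)

Section euclidean_norm.
Context {R : realType} {N : nat}.
Implicit Types (x y z : 'rV[R]_N) (r : R).

(** Cauchy-Schwarz, from an identity that writes [B * (A * B - C ^+ 2)] as a sum of squares;
    cancelling [B] leaves the case [B = 0], where [b] vanishes. *)
Lemma sqr_sum_mul_le (a b : 'I_N -> R) :
  (\sum_i a i * b i) ^+ 2 <= (\sum_i a i ^+ 2) * (\sum_i b i ^+ 2).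
Proof.
set A := \sum_i a i ^+ 2; set B := \sum_i b i ^+ 2; set C := \sum_i a i * b i.
have B0 : 0 <= B by apply: sumr_ge0 => i _; exact: sqr_ge0.
have key : 0 <= B * (A * B - C ^+ 2).
  have -> : B * (A * B - C ^+ 2) = \sum_i (B * a i - C * b i) ^+ 2.
    have E i : (B * a i - C * b i) ^+ 2 =
        B ^+ 2 * (a i ^+ 2) + (- (2 * B * C)) * (a i * b i) + C ^+ 2 * (b i ^+ 2).
      by ring.
    under eq_bigr do rewrite E.
    by rewrite !big_split/= -!mulr_sumr -/A -/B -/C; ring.
  by apply: sumr_ge0 => i _; exact: sqr_ge0.
have [B0'|B0'] := eqVneq B 0; last first.
  by rewrite -subr_ge0 -(pmulr_rge0 _ (_ : 0 < B))// lt_neqAle eq_sym B0'.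
have b0 i : b i = 0.
  apply/eqP; rewrite -sqrf_eq0; apply/eqP.
  by apply: (psumr_eq0P _ B0') => // j _; exact: sqr_ge0.
by rewrite B0' mulr0 /C big1 ?expr0n// => i _; rewrite b0 mulr0.
Qed.

Lemma euc_norm_ge0 x : 0 <= euc_norm x.
Proof. exact: sqrtr_ge0. Qed.

Lemma sqr_euc_norm x : euc_norm x ^+ 2 = \sum_i x ord0 i ^+ 2.
Proof. by rewrite sqr_sqrtr// sumr_ge0// => i _; exact: sqr_ge0. Qed.

Lemma euc_normZ r x : euc_norm (r *: x) = `|r| * euc_norm x.
Proof.
rewrite /euc_norm -[X in X * _]sqrtr_sqr -sqrtrM ?sqr_ge0// mulr_sumr.
by congr Num.sqrt; apply: eq_bigr => i _; rewrite mxE exprMn.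
Qed.

Lemma euc_normN x : euc_norm (- x) = euc_norm x.
Proof. by rewrite -scaleN1r euc_normZ normrN1 mul1r. Qed.

Lemma euc_norm0 : euc_norm (0 : 'rV[R]_N) = 0.
Proof. by rewrite -(scale0r 0) euc_normZ normr0 mul0r. Qed.

Lemma euc_distC x y : euc_norm (x - y) = euc_norm (y - x).
Proof. by rewrite -euc_normN opprB. Qed.

Lemma euc_normD x y : euc_norm (x + y) <= euc_norm x + euc_norm y.
Proof.
rewrite -(@ler_pXn2r _ 2)// ?nnegrE ?addr_ge0 ?euc_norm_ge0//.
rewrite sqrrD !sqr_euc_norm.
under eq_bigr do rewrite mxE sqrrD.
rewrite !big_split/= lerD2r lerD2l -mulr2n ler_pMn2r//.
rewrite (le_trans (ler_norm _))// -(@ler_pXn2r _ 2)// ?nnegrE ?mulr_ge0 ?euc_norm_ge0//.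
by rewrite real_normK ?num_real// exprMn !sqr_euc_norm sqr_sum_mul_le.
Qed.

Lemma euc_dist_triangle x y z : euc_norm (x - z) <= euc_norm (x - y) + euc_norm (y - z).
Proof. by rewrite (le_trans _ (euc_normD _ _))// addrA subrK. Qed.

Lemma coord_le_euc_norm x i : `|x ord0 i| <= euc_norm x.
Proof.
rewrite -sqrtr_sqr ler_wsqrtr// (bigD1 i)//= lerDl.
by apply: sumr_ge0 => j _; exact: sqr_ge0.
Qed.

Lemma coord_le_norm x i : `|x ord0 i| <= `|x|.
Proof.
by rewrite [leRHS]/Num.norm/= mx_normrE; apply/bigmax_geP; right; exists (ord0, i).
Qed.

Lemma norm_le_coord x r : 0 <= r -> (forall i, `|x ord0 i| <= r) -> `|x| <= r.
Proof.
move=> r0 xr; rewrite [leLHS]/Num.norm/= mx_normrE; apply/bigmax_leP; split => //.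
by move=> [j i] _ /=; rewrite ord1.
Qed.

Lemma norm_le_euc_norm x : `|x| <= euc_norm x.
Proof. by apply: norm_le_coord; [exact: euc_norm_ge0|exact: coord_le_euc_norm]. Qed.

Lemma euc_norm_continuous : continuous (@euc_norm R N).
Proof.
move=> x; rewrite /euc_norm.
apply: (@continuous_comp _ _ _ (fun x : 'rV[R]_N => \sum_(i < N) x ord0 i ^+ 2) Num.sqrt).
  apply: (@cvg_big _ _ _ _ xpredT _ _ (nbhs x) _ 
    (fun i (x : 'rV[R]_N) => x ord0 i ^+ 2)) => [|i _]; first exact: add_continuous.
  apply: (@continuous_comp _ _ _ (fun y : 'rV[R]_N => y ord0 i) (fun t => t ^+ 2)).
    exact: coord_continuous.
  exact: exprn_continuous.
exact: sqrt_continuous.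
Qed.

End euclidean_norm.

Section distance.
Context {R : realType} {N : nat}.
Implicit Types (x y z : 'rV[R]_N) (A : set 'rV[R]_N).

Lemma euc_dist_le x A z : A z -> euc_dist x A <= euc_norm (x - z).
Proof.
move=> Az; apply: ge_inf; last by exists z.
by exists 0 => _ [y _ <-]; exact: euc_norm_ge0.
Qed.

Lemma le_euc_dist x A (r : R) : A !=set0 ->
  (forall z, A z -> r <= euc_norm (x - z)) -> r <= euc_dist x A.
Proof.
move=> [a Aa] rA; apply: lb_le_inf; first by exists (euc_norm (x - a)), a.
by move=> _ [y Ay <-]; exact: rA.
Qed.

Lemma euc_dist_lip x y A : A !=set0 -> euc_dist x A - euc_dist y A <= euc_norm (x - y).
Proof.
move=> A0; rewrite lerBlDr addrC -lerBlDr; apply: le_euc_dist => // z Az.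
rewrite lerBlDr (le_trans (euc_dist_le x Az))//.
by rewrite [leRHS]addrC; exact: euc_dist_triangle.
Qed.

Lemma abs_euc_distB x y A : A !=set0 -> `|euc_dist x A - euc_dist y A| <= euc_norm (x - y).
Proof.
move=> A0; have := euc_dist_lip x y A0; have := euc_dist_lip y x A0.
by rewrite (euc_distC y) ler_norml => ? ?; apply/andP; split; lra.
Qed.

End distance.

(** * Open sets belong to the sigma-algebra generated by the coordinates *)

Section borel_RN.
Context {R : realType} {N : nat}.

Lemma measurable_coord (i : 'I_N) : measurable_fun setT (fun x : RN R N => x ord0 i).
Proof.
by move=> _ B mB; rewrite setTI; apply: sub_sigma_algebra; exists i, B.
Qed.

Lemma measurable_fun_RN d (T : measurableType d) (f : T -> RN R N) :
  (forall i, measurable_fun setT (fun t => f t ord0 i)) -> measurable_fun setT f.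
Proof.
move=> mf; apply: (@measurability _ _ _ (RN R N) _ _ (coord_sets R N)) => //.
move=> _ [_ [i [B [mB ->]]] <-].
by have := mf i measurableT B mB.
Qed.

Lemma measurable_norm_ball (q : 'rV[R]_N) (e : R) : 0 < e ->
  measurable ([set x | `|q - x| < e] : set (RN R N)).
Proof.
move=> e0; rewrite [X in measurable X](_ : _ = \bigcap_(i in [set: 'I_N])
    (fun x : RN R N => x ord0 i) @^-1` [set t | `|q ord0 i - t| < e]).
  apply: fin_bigcap_measurable => // i _; rewrite -[X in measurable X]setTI.
  apply: measurable_coord => //; rewrite [X in measurable X](_ : _ = ball (q ord0 i) e)//.
  apply: open_measurable; exact: ball_open.
rewrite predeqE => x /=; split => [xe i _ /=|xe].
  by apply: le_lt_trans xe; have := coord_le_norm (q - x) i; rewrite !mxE.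
have : ball q e x by split => // i j; rewrite ord1; exact: xe.
by rewrite mx_norm_ball.
Qed.

(** Second countability: [A] is the union of the sup-norm balls with rational centre and radius
    [1/(k+1)] that it contains. Sup-norm balls are used because they are finite intersections of
    coordinate slabs. *)
Lemma open_measurable_RN (A : set 'rV[R]_N) : open A -> measurable (A : set (RN R N)).
Proof.
move=> oA.
pose B (p : 'rV[rat]_N * nat) := [set x : 'rV[R]_N | `|map_mx ratr p.1 - x| < p.2.+1%:R^-1].
rewrite [X in measurable X](_ : _ = \bigcup_p
    (if `[< B p `<=` A >] then B p else set0)).
  apply: countable_bigcupT_measurable => [|p]; first exact: countableP.
  by case: ifP => // _; apply: measurable_norm_ball; rewrite invr_gt0.
rewrite predeqE => x; split => [Ax|[p _]]; last first.
  by case: ifP => // /asboolP; exact.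
move: oA; rewrite openE => /(_ _ Ax) /nbhs_ballP[e /= e0 xeA].
(* Two points of one ball of radius [1/(k+1)] are less than [2/(k+1)] apart, so half of [e]
   suffices. *)
have [k ke] : exists k, k.+1%:R^-1 < e / 2.
  exists (Num.truncn (e / 2)^-1); rewrite invf_plt ?posrE ?divr_gt0//.
  exact: truncnS_gt.
have k0 : 0 < k.+1%:R^-1 :> R by rewrite invr_gt0.
have /choice[q qP] i : exists q : rat, `|ratr q - x ord0 i| < k.+1%:R^-1.
  have [q] := @rat_in_itvoo R (x ord0 i - k.+1%:R^-1) (x ord0 i + k.+1%:R^-1)
    ltac:(by rewrite ltrD2l gt0_cp).
  rewrite in_itv/= => /andP[xq qx]; exists q; move: xq qx.
  move: (k.+1%:R^-1) => c ? ?.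
  by rewrite ltr_norml; apply/andP; split; lra.
have bx : B (\row_i q i, k) x.
  rewrite /B/=; have : ball (map_mx ratr (\row_i q i) : 'rV[R]_N) k.+1%:R^-1 x.
    by split => // i j; rewrite ord1 !mxE; exact: qP.
  by rewrite mx_norm_ball.
exists (\row_i q i, k) => //; rewrite ifT//; apply/asboolP => y By; apply: xeA.
rewrite mx_norm_ball /ball_/=.
have -> : x - y = (map_mx ratr (\row_i q i) - y) - (map_mx ratr (\row_i q i) - x).
  by rewrite opprB [RHS]addrC addrA subrK.
rewrite (le_lt_trans (ler_normB _ _))//.
by move: bx By ke; rewrite /B/=; move: (k.+1%:R^-1) => c; lra.
Qed.

Lemma closed_measurable_RN (A : set 'rV[R]_N) : closed A -> measurable (A : set (RN R N)).
Proof.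
move=> cA; rewrite -(setCK A); apply: measurableC; apply: open_measurable_RN.
exact: closed_openC.
Qed.

Lemma continuous_measurable_RN (f : 'rV[R]_N -> R) : continuous f ->
  measurable_fun setT (f : RN R N -> R).
Proof.
move=> cf; apply: (measurability _ (RGenOpens.measurableE R)).
move=> _ [_ [a [b ->]] <-]; rewrite setTI; apply: open_measurable_RN.
by apply: open_comp => //; exact: interval_open.
Qed.

End borel_RN.

Section image_measure.
Context d1 d2 (X : measurableType d1) (Y : measurableType d2) (R : realType).
Variables (mu : {measure set X -> \bar R}) (phi : X -> Y) (mphi : measurable_fun setT phi).

Definition image_measure : {measure set Y -> \bar R}.
Proof. by refine [the {measure set Y -> \bar R} of pushforward mu phi]; exact: mphi. Defined.

Lemma ge0_integral_image (D : set Y) (f : Y -> \bar R) : measurable D ->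
  measurable_fun D f -> (forall y, D y -> (0 <= f y)%E) ->
  (\int[image_measure]_(y in D) f y = \int[mu]_(x in phi @^-1` D) f (phi x))%E.
Proof.
move=> mD mf f0; apply: ge0_integral_pushforward => //.
by move=> y /set_mem; exact: f0.
Qed.

End image_measure.
Arguments image_measure {d1 d2 X Y R} mu {phi} mphi.

(** * Lebesgue measure *)

Section boxes.
Context {R : realType} {N : nat}.
Implicit Types (a b x : 'rV[R]_N).

Definition box a b : set (RN R N) :=
  [set x : RN R N | forall i, a ord0 i < x ord0 i <= b ord0 i].

Definition boxes : set (set (RN R N)) :=
  [set A | exists a b, (forall i, a ord0 i <= b ord0 i) /\ A = box a b].

Lemma measurable_box a b : measurable (box a b).
Proof.
rewrite [X in measurable X](_ : _ = \bigcap_(i in [set: 'I_N])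
    (fun x : RN R N => x ord0 i) @^-1` `]a ord0 i, b ord0 i]).
  apply: fin_bigcap_measurable => // i _; rewrite -[X in measurable X]setTI.
  exact: measurable_coord.
rewrite predeqE => x; split => [xab i _ /=|xab i]; first by rewrite in_itv/= xab.
by have := xab i I; rewrite /= in_itv.
Qed.

Lemma boxes_setI : setI_closed boxes.
Proof.
move=> _ _ [a [b [ab ->]]] [a' [b' [ab' ->]]].
exists (\row_i Num.max (a ord0 i) (a' ord0 i)).
(* The outer maximum with the lower corner keeps the corners ordered when the intersection is
   empty. *)
exists (\row_i Num.max (Num.max (a ord0 i) (a' ord0 i)) (Num.min (b ord0 i) (b' ord0 i))).
split=> [i|]; first by rewrite !mxE le_max lexx.
rewrite predeqE => x; split => [[xab xab'] i|xab].
  have /andP[ax xb] := xab i; have /andP[ax' xb'] := xab' i.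
  by rewrite !mxE gt_max le_max le_min ax ax' xb xb' orbT.
have H i : (a ord0 i < x ord0 i <= b ord0 i) /\ (a' ord0 i < x ord0 i <= b' ord0 i).
  have := xab i; rewrite !mxE gt_max => /andP[/andP[ax a'x]].
  by rewrite ax a'x/= !le_max le_min -orbA !leNgt ax a'x/= => /andP.
by split => i; have [] := H i.
Qed.

Lemma coord_measurable_boxes (i : 'I_N) :
  measurable_fun setT (fun x : g_sigma_algebraType boxes => (x : 'rV[R]_N) ord0 i).
Proof.
apply: (measurability _ (RGenOInfty.measurableE R)) => //.
move=> _ [_ [t ->] <-]; rewrite setTI.
(* A half-space is exhausted by boxes; [Num.max t n%:R] keeps the [i]-th side ordered for small
   [n]. *)
rewrite [X in measurable X](_ : _ = \bigcup_n
   box (\row_j if j == i then t else - n%:R) (\row_j if j == i then Num.max t n%:R else n%:R)).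
  apply: bigcupT_measurable => n; apply: sub_sigma_algebra.
  do 2 eexists; split; last reflexivity.
  move=> j; rewrite !mxE; case: ifP => _; rewrite ?le_max ?lexx//.
  by rewrite (le_trans (_ : _ <= 0))// oppr_le0.
rewrite predeqE => x /=; rewrite in_itv/= andbT; split => [tx|[n _ /(_ i)]]; last first.
  by rewrite !mxE eqxx => /andP[].
have [n xn] : exists n : nat, `|x : 'rV[R]_N| < n%:R.
  by exists (Num.truncn `|x : 'rV[R]_N|).+1; exact: truncnS_gt.
exists n => // j; rewrite !mxE.
have : `|(x : 'rV[R]_N) ord0 j| < n%:R by apply: le_lt_trans xn; exact: coord_le_norm.
rewrite ltr_norml => /andP[nx xn'].
case: ifPn => [/eqP ji|_]; last by rewrite nx ltW.
by subst j; rewrite tx le_max (ltW xn') orbT.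
Qed.

Lemma measurable_boxesE : @measurable _ (RN R N) = <<s boxes >>.
Proof.
rewrite eqEsubset; split.
  apply: smallest_sub; first exact: smallest_sigma_algebra.
  move=> _ [i [B [mB ->]]].
  by have := coord_measurable_boxes i measurableT mB; rewrite setTI.
apply: smallest_sub; first exact: sigma_algebra_measurable.
by move=> _ [a [b [_ ->]]]; exact: measurable_box.
Qed.

Lemma box_cover : \bigcup_k box (const_mx (- k%:R)) (const_mx k%:R) = setT.
Proof.
rewrite -subTset => x _.
have [n xn] : exists n : nat, `|x : 'rV[R]_N| < n%:R.
  by exists (Num.truncn `|x : 'rV[R]_N|).+1; exact: truncnS_gt.
exists n => // j; rewrite !mxE.
have : `|(x : 'rV[R]_N) ord0 j| < n%:R by apply: le_lt_trans xn; exact: coord_le_norm.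
by rewrite ltr_norml => /andP[-> /ltW ->].
Qed.

(** Boxes form a generating pi-system, and the cubes [(-k, k]^N] exhaust the space with finite
    measure. *)
Lemma RN_measure_unique (m1 m2 : {measure set (RN R N) -> \bar R}) :
  (forall a b, (forall i, a ord0 i <= b ord0 i) -> m1 (box a b) = m2 (box a b)) ->
  (forall a b, (forall i, a ord0 i <= b ord0 i) -> (m1 (box a b) < +oo)%E) ->
  forall A, measurable A -> m1 A = m2 A.
Proof.
move=> m12 m1oo A mA.
have ab k i : (const_mx (- k%:R) : 'rV[R]_N) ord0 i <= (const_mx k%:R : 'rV[R]_N) ord0 i.
  by rewrite !mxE (le_trans (_ : _ <= 0))// oppr_le0.
apply: (measure_unique boxes (fun k => box (const_mx (- k%:R)) (const_mx k%:R))) => //.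
- exact: measurable_boxesE.
- exact: boxes_setI.
- by move=> k; exists (const_mx (- k%:R)), (const_mx k%:R).
- exact: box_cover.
- by move=> _ [a [b [? ->]]]; exact: m12.
- by move=> k; exact: m1oo.
Qed.

End boxes.

Lemma ge0_integral_mrestr d (T : measurableType d) (R : realType)
    (mu : {measure set T -> \bar R}) (D : set T) (mD : measurable D) (f : T -> \bar R) :
  measurable_fun setT f -> (forall x, (0 <= f x)%E) ->
  (\int[mrestr mu mD]_x f x = \int[mu]_(x in D) f x)%E.
Proof.
move=> mf f0.
rewrite -(setUv D) ge0_integral_setU//; last 3 first.
- exact: measurableC.
- by rewrite setUv.
- by apply/disj_setPS; rewrite setICr.
rewrite [X in (_ + X)%E](eq_measure_integral mzero); last first.
  move=> A mA AD; rewrite /= /mrestr (_ : A `&` D = set0) ?measure0//.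
  by rewrite -subset0 => x [/AD].
rewrite integral_measure_zero adde0; apply: eq_measure_integral => A mA AD.
by rewrite /= /mrestr; congr (mu _); apply/setIidPl.
Qed.

(** * Scaling, reflection and integrals over balls *)

Section lebesgue.
Context {R : realType} {N : nat}.
Variables (lam : {measure set (RN R N) -> \bar R}) (hlam : is_lebesgue_RN lam).
Implicit Types (a b x : 'rV[R]_N).

Lemma lebesgue_box a b : (forall i, a ord0 i <= b ord0 i) ->
  lam (box a b) = (\prod_(i < N) (b ord0 i - a ord0 i))%:E.
Proof. exact: hlam. Qed.

Lemma lebesgue_box_lty a b : (forall i, a ord0 i <= b ord0 i) -> (lam (box a b) < +oo)%E.
Proof. by move=> ab; rewrite lebesgue_box// ltry. Qed.

Lemma measurable_affine (c : R) x :
  measurable_fun setT ((fun y : 'rV[R]_N => x + c *: y) : RN R N -> RN R N).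
Proof.
apply: measurable_fun_RN => i.
rewrite (_ : (fun _ => _) = fun t : RN R N => x ord0 i + c * t ord0 i); last first.
  by apply/funext => t; rewrite !mxE.
by apply: measurable_funD => //; apply: measurable_funM => //; exact: measurable_coord.
Qed.

(** Both sides are measures in [A], so boxes suffice. As [r] is positive, the pullback of a
    half-open box is again a box with the same open sides. *)
Lemma lebesgue_affine (r : R) x (A : set (RN R N)) : 0 < r -> measurable A ->
  lam A = ((r ^+ N)%:E * lam ((fun y : 'rV[R]_N => (x + r *: y)%R) @^-1` A))%E.
Proof.
move=> r0 mA.
pose k : {nonneg R} := NngNum (ltW (exprn_gt0 N r0)).
transitivity (mscale k (image_measure lam (measurable_affine r x)) A); last by [].
apply: RN_measure_unique => // [a b ab|a b ab]; last exact: lebesgue_box_lty.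
have pre : (fun y : 'rV[R]_N => x + r *: y) @^-1` box a b =
    box (r^-1 *: (a - x)) (r^-1 *: (b - x)).
  rewrite predeqE => y; split => yab i; have := yab i; rewrite !mxE.
    by rewrite ltr_pdivrMl// ler_pdivlMl// ltrBlDl lerBrDl.
  by rewrite ltr_pdivrMl// ler_pdivlMl// ltrBlDl lerBrDl.
rewrite [RHS](_ : _ = ((r ^+ N)%:E * lam ((fun y : 'rV[R]_N => (x + r *: y)%R) @^-1` box a b))%E)//.
rewrite pre !lebesgue_box//; last first.
  by move=> i; rewrite !mxE ler_pM2l ?invr_gt0// lerD2r.
rewrite -EFinM; congr EFin.
rewrite -[X in r ^+ X]card_ord -prodr_const -big_split/=.
by apply: eq_bigr => i _; rewrite !mxE; field; rewrite gt_eqF.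
Qed.

(** Reflection sends [(a, b]] to [[-b, -a)], which is not a box. It is squeezed between the boxes
    [(-b, max(-b, -a - d)]] and [(-b - d, -a]], whose volumes [q d] and [p d] have the same limit as
    [d] decreases to 0. *)
Lemma lebesgue_opp_box a b : (forall i, a ord0 i <= b ord0 i) ->
  lam ((fun y : RN R N => 0 + (-1) *: y) @^-1` box a b) = lam (box a b).
Proof.
move=> ab; set A := _ @^-1` _.
have mA : measurable A.
  by rewrite /A -[X in measurable X]setTI; exact: measurable_affine (measurable_box _ _).
have yA y : A y <-> forall i, - b ord0 i <= y ord0 i < - a ord0 i.
  by split => + i => /(_ i); rewrite !mxE add0r mulN1r andbC lerNl ltrNr.
pose p (d : R) := \prod_(i < N) (b ord0 i - a ord0 i + d).
pose q (d : R) := \prod_(i < N) Num.max 0 (b ord0 i - a ord0 i - d).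
have ub d : 0 < d -> (lam A <= (p d)%:E)%E.
  move=> d0; have -> : p d = \prod_(i < N) ((- a) ord0 i - (- b - const_mx d) ord0 i).
    by apply: eq_bigr => i _; rewrite !mxE; ring.
  rewrite -lebesgue_box; last by move=> i; rewrite !mxE; have := ab i; lra.
  apply: le_measure; rewrite ?inE//; first exact: measurable_box.
  by move=> y /yA yab i; rewrite !mxE; have /andP[? ?] := yab i; apply/andP; split; lra.
have lb d : 0 < d -> ((q d)%:E <= lam A)%E.
  move=> d0; pose c : 'rV[R]_N := \row_i Num.max (- b ord0 i) (- a ord0 i - d).
  have -> : q d = \prod_(i < N) (c ord0 i - (- b) ord0 i).
    apply: eq_bigr => i _; rewrite !mxE; by case: leP => ?; case: leP => ?; lra.
  rewrite -lebesgue_box; last by move=> i; rewrite !mxE le_max lexx.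
  apply: le_measure; rewrite ?inE//; first exact: measurable_box.
  move=> y yc; apply/yA => i; have := yc i; rewrite !mxE le_max.
  by move=> /andP[? /orP[?|?]]; apply/andP; split; lra.
have cp : p d @[d --> 0^'+] --> p 0.
  apply: (@cvg_big _ _ _ _ xpredT) => [|i _]; first exact: mul_continuous.
  by apply: cvgD; [exact: cvg_cst|apply: cvg_at_right_filter; exact: cvg_id].
have cq : q d @[d --> 0^'+] --> q 0.
  apply: (@cvg_big _ _ _ _ xpredT) => [|i _]; first exact: mul_continuous.
  apply: cvg_at_right_filter.
  apply: (@continuous_max R _ (fun=> 0) (fun d => b ord0 i - a ord0 i - d)).
    exact: cst_continuous.
  by apply: cvgB; [exact: cvg_cst|exact: cvg_id].
have pq : p 0 = q 0.
  by apply: eq_bigr => i _; rewrite addr0 subr0 max_r// subr_ge0.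
have lamA : lam A \is a fin_num.
  by rewrite ge0_fin_numE// (le_lt_trans (ub 1 _))// ltry.
rewrite lebesgue_box// -[LHS]fineK//; congr EFin.
have -> : \prod_(i < N) (b ord0 i - a ord0 i) = p 0.
  by apply: eq_bigr => i _; rewrite addr0.
apply/eqP; rewrite eq_le; apply/andP; split.
- apply: (cvgr_to_ge cp); near=> d.
  by rewrite -lee_fin fineK// ub.
- rewrite pq; apply: (cvgr_to_le cq); near=> d.
  by rewrite -lee_fin fineK// lb.
Unshelve. all: by end_near. Qed.

Lemma lebesgue_opp (A : set (RN R N)) : measurable A ->
  lam ((fun y : RN R N => 0 + (-1) *: y) @^-1` A) = lam A.
Proof.
move=> mA; apply/esym.
transitivity (image_measure lam (measurable_affine (-1) 0) A); last by [].
apply: RN_measure_unique => // [a b ab|a b ab]; last exact: lebesgue_box_lty.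
by rewrite -lebesgue_opp_box.
Qed.

Lemma open_euc_ball x (r : R) : open (euc_ball x r).
Proof.
rewrite (_ : euc_ball x r = (fun y => euc_norm (y - x)) @^-1` [set t | t < r])//.
have cn : continuous (fun y : 'rV[R]_N => euc_norm (y - x)).
  move=> y; apply: (@continuous_comp 'rV[R]_N 'rV[R]_N R (fun z => z - x)); last first.
    exact: euc_norm_continuous.
  apply: (@continuousB R 'rV[R]_N 'rV[R]_N id (cst x)); first exact: cvg_id.
  exact: cst_continuous.
by apply: open_comp => [y _|]; [exact: cn|exact: open_lt].
Qed.

Lemma measurable_euc_ball x (r : R) : measurable (euc_ball x r : set (RN R N)).
Proof. by apply: open_measurable_RN; exact: open_euc_ball. Qed.

Lemma preimage_affine_euc_ball x (r : R) : 0 < r ->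
  (fun y : 'rV[R]_N => x + r *: y) @^-1` euc_ball x r = euc_ball 0 1.
Proof.
move=> r0; rewrite predeqE => y; rewrite /euc_ball/= addrAC subrr add0r subr0.
by rewrite euc_normZ gtr0_norm// gtr_pMr.
Qed.

Lemma lebesgue_euc_ball x (r : R) : 0 < r ->
  lam (euc_ball x r) = ((r ^+ N)%:E * lam (euc_ball 0 1))%E.
Proof.
move=> r0; rewrite (lebesgue_affine x r0)//; last exact: measurable_euc_ball.
by rewrite preimage_affine_euc_ball.
Qed.

Lemma lebesgue_unit_ball_lty : (lam (euc_ball 0 1) < +oo)%E.
Proof.
have ab i : (const_mx (- 1) : 'rV[R]_N) ord0 i <= (const_mx 1 : 'rV[R]_N) ord0 i.
  by rewrite !mxE; lra.
apply: le_lt_trans (lebesgue_box_lty ab).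
apply: le_measure; rewrite ?inE; [exact: measurable_euc_ball|exact: measurable_box|].
move=> x; rewrite /euc_ball/= subr0 => x1 i; rewrite !mxE.
have : `|x ord0 i| < 1 by apply: le_lt_trans x1; exact: coord_le_euc_norm.
by rewrite ltr_norml => /andP[-> /ltW ->].
Qed.

Lemma lebesgue_unit_ball_gt0 : (0 < lam (euc_ball 0 1))%E.
Proof.
have /nbhs_ballP[e /= e0 eB] : nbhs (0 : 'rV[R]_N) (euc_ball 0 1).
  by apply: open_nbhs_nbhs; split; [exact: open_euc_ball|rewrite /euc_ball/= subr0 euc_norm0].
have ab i : (const_mx (- (e / 2)) : 'rV[R]_N) ord0 i <= (const_mx (e / 2) : 'rV[R]_N) ord0 i.
  by rewrite !mxE; lra.
apply: (@lt_le_trans _ _ (lam (box (const_mx (- (e / 2))) (const_mx (e / 2))))).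
  rewrite lebesgue_box// lte_fin; apply: prodr_gt0 => i _; rewrite !mxE; lra.
apply: le_measure; rewrite ?inE; [exact: measurable_box|exact: measurable_euc_ball|].
move=> x xe; apply: eB; rewrite mx_norm_ball /ball_/= sub0r normrN.
apply: (@le_lt_trans _ _ (e / 2)); last lra.
apply: norm_le_coord; first lra.
by move=> i; have := xe i; rewrite !mxE ler_norml => /andP[/ltW -> ->].
Qed.

Definition vol : R := fine (lam (euc_ball 0 1)).

Lemma vol_gt0 : 0 < vol.
Proof. by rewrite fine_gt0// lebesgue_unit_ball_gt0 lebesgue_unit_ball_lty. Qed.

Lemma lebesgue_euc_ballE x (r : R) : 0 < r -> lam (euc_ball x r) = (r ^+ N * vol)%:E.
Proof.
move=> r0; rewrite lebesgue_euc_ball// EFinM /vol fineK//.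
by rewrite ge0_fin_numE// lebesgue_unit_ball_lty.
Qed.

Local Open Scope ereal_scope.

Lemma ge0_integral_euc_ball x (r : R) (f : RN R N -> \bar R) : (0 < r)%R ->
  measurable_fun setT f -> (forall y, 0 <= f y) ->
  \int[lam]_(y in euc_ball x r) f y =
  (r ^+ N)%:E * \int[lam]_(y in euc_ball 0 1) f (x + r *: y)%R.
Proof.
move=> r0 mf f0.
pose k : {nonneg R} := NngNum (ltW (exprn_gt0 N r0)).
transitivity (\int[mscale k (image_measure lam (measurable_affine r x))]_(y in euc_ball x r) f y).
  apply: eq_measure_integral => A mA _; exact: lebesgue_affine.
have mB := measurable_euc_ball x r.
rewrite ge0_integral_mscale//; last exact: measurable_funS mf.
congr (_ * _); rewrite ge0_integral_image//; last exact: measurable_funS mf.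
by rewrite preimage_affine_euc_ball.
Qed.

Lemma integral_unit_ball_sym (f : RN R N -> \bar R) :
  measurable_fun setT f -> (forall y, 0 <= f y) ->
  \int[lam]_(y in euc_ball 0 1) f y = \int[lam]_(y in euc_ball 0 1) f (- y)%R.
Proof.
move=> mf f0.
have mB := measurable_euc_ball 0 1.
transitivity (\int[image_measure lam (measurable_affine (-1) 0)]_(y in euc_ball 0 1) f y).
  by apply: eq_measure_integral => A mA _; rewrite -lebesgue_opp.
rewrite ge0_integral_image//; last exact: measurable_funS mf.
rewrite (_ : _ @^-1` _ = euc_ball 0 1); last first.
  by rewrite predeqE => y; rewrite /euc_ball/= add0r scaleN1r !subr0 euc_normN.
by apply: eq_integral => y _; rewrite add0r scaleN1r.
Qed.

(* Symmetrisation: [f y + f (- y) = 2 c], so no integrability of coordinates is needed. *)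
Lemma integral_unit_ball_coord (c s : R) (i : 'I_N) :
  (forall y, euc_ball 0 1 y -> 0 <= c + s * y ord0 i)%R ->
  \int[lam]_(y in euc_ball 0 1) (c + s * (y : 'rV[R]_N) ord0 i)%:E = (c * vol)%:E.
Proof.
(* Truncation at 0 changes nothing on the ball but makes the integrand nonnegative on the whole
   space. *)
move=> cs0; pose f (y : RN R N) := (Num.max 0 (c + s * (y : 'rV[R]_N) ord0 i))%R.
have mB : measurable (euc_ball 0 1 : set (RN R N)) := measurable_euc_ball 0 1.
have mf : measurable_fun setT f.
  apply: measurable_maxr => //; apply: measurable_funD => //; apply: measurable_funM => //.
  exact: measurable_coord.
have f0 y : 0 <= (f y)%:E by rewrite lee_fin le_max lexx.
have fE y : euc_ball 0 1 y -> f y = (c + s * (y : 'rV[R]_N) ord0 i)%R.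
  by move=> yB; rewrite /f max_r// cs0.
have mf' : measurable_fun setT (EFin \o f) by exact/measurable_EFinP.
have mfN : measurable_fun setT (fun y : RN R N => (f (- (y : 'rV[R]_N))%R)%:E).
  have := measurable_affine (-1) 0 => /(measurableT_comp mf').
  by apply: eq_measurable_fun => y _; rewrite /= add0r scaleN1r.
set I := LHS.
have IE : I = \int[lam]_(y in euc_ball 0 1) (f y)%:E.
  by apply: eq_integral => y /set_mem yB; rewrite fE.
have vB : lam (euc_ball 0 1) = vol%:E.
  by rewrite (@lebesgue_euc_ballE 0 1%R)// expr1n mul1r.
have I2 : I + I = (c * vol + c * vol)%:E.
  rewrite {2}IE integral_unit_ball_sym// IE -ge0_integralD//; last 2 first.
    exact: measurable_funS mf'.
    exact: measurable_funS mfN.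
  transitivity (\int[lam]_(y in euc_ball 0 1) (2 * c)%:E).
    apply: eq_integral => y /set_mem yB; rewrite -EFinD; congr EFin.
    rewrite !fE ?mxE//; first by ring.
    by move: yB; rewrite /euc_ball/= !subr0 euc_normN.
  by rewrite integral_cst// vB -EFinM; congr EFin; ring.
have Ifin : I \is a fin_num.
  rewrite ge0_fin_numE; last by rewrite IE integral_ge0.
  rewrite ltey; apply/eqP => Ioo; by move: I2; rewrite Ioo.
rewrite -(fineK Ifin); congr EFin.
by move: I2; rewrite -(fineK Ifin) -EFinD => -[]; lra.
Qed.

End lebesgue.

(** * The shift on the path space *)

Section product_law.
Context {R : realType} {N : nat}.

Lemma measurable_coordO n : measurable_fun setT (fun w : Omega R N => w n : RN R N).
Proof.
by move=> _ B mB; rewrite setTI; apply: sub_sigma_algebra; exists n, B.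
Qed.

Lemma measurable_fun_Omega d (T : measurableType d) (f : T -> Omega R N) :
  (forall n, measurable_fun setT (fun t => f t n : RN R N)) -> measurable_fun setT f.
Proof.
move=> mf; apply: (@measurability _ _ _ (Omega R N) _ _ (cyl_sets R N)) => //.
move=> _ [_ [i [B [mB ->]]] <-].
by have := mf i measurableT B mB.
Qed.

Definition Omega_shift (w : Omega R N) : Omega R N := fun n => w n.+1.

Lemma measurable_shift : measurable_fun setT Omega_shift.
Proof. by apply: measurable_fun_Omega => n; exact: (measurable_coordO n.+1). Qed.

Definition cylinder n (A : nat -> set (RN R N)) : set (Omega R N) :=
  [set w | forall i, (i < n)%N -> A i (w i)].

Definition cylinders : set (set (Omega R N)) :=
  [set C | exists n A, (forall i, measurable (A i)) /\ C = cylinder n A].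

Lemma measurable_cylinder n (A : nat -> set (RN R N)) : (forall i, measurable (A i)) ->
  measurable (cylinder n A).
Proof.
move=> mA; rewrite [X in measurable X](_ : _ = \bigcap_(i in [set i | (i < n)%N])
    (fun w : Omega R N => w i : RN R N) @^-1` A i)//.
apply: bigcap_measurableType => //.
by move=> i _; rewrite -[X in measurable X]setTI; exact: measurable_coordO.
Qed.

Lemma cylinders_setI : setI_closed cylinders.
Proof.
move=> _ _ [n [A [mA ->]]] [m [B [mB ->]]]; exists (maxn n m).
(* Beyond its own length each cylinder is padded with [setT]. *)
exists (fun i => (if (i < n)%N then A i else setT) `&` (if (i < m)%N then B i else setT)).
split; first by move=> i; apply: measurableI; case: ifP.
rewrite predeqE => w; split => [[wA wB] i _|wAB].
  by split; case: ifP => // ?; [exact: wA|exact: wB].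
split => i il.
  by have [] := wAB i; rewrite ?leq_max ?il.
by have := wAB i; rewrite leq_max il orbT => /(_ isT)[_].
Qed.

Lemma measurable_cylindersE : @measurable _ (Omega R N) = <<s cylinders >>.
Proof.
rewrite eqEsubset; split.
  apply: smallest_sub; first exact: smallest_sigma_algebra.
  move=> _ [n [A [mA ->]]]; apply: sub_sigma_algebra.
  exists n.+1, (fun i => if i == n then A else setT); split.
    by move=> i; case: ifP.
  rewrite predeqE => w; split => [wA i _|/(_ n (ltnSn n))]; last by rewrite eqxx.
  by case: ifP => // /eqP ->.
apply: smallest_sub; first exact: sigma_algebra_measurable.
by move=> _ [n [A [mA ->]]]; exact: measurable_cylinder.
Qed.

Lemma Omega_measure_unique (m1 m2 : {measure set (Omega R N) -> \bar R}) :
  (forall n A, (forall i, measurable (A i)) -> m1 (cylinder n A) = m2 (cylinder n A)) ->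
  (m1 setT < +oo)%E ->
  forall A, measurable A -> m1 A = m2 A.
Proof.
move=> m12 m1oo A mA.
apply: (measure_unique cylinders (fun k => setT)) => //.
- exact: measurable_cylindersE.
- exact: cylinders_setI.
- by move=> k; exists 0%N, (fun=> setT); split => //; rewrite predeqE.
- by rewrite bigcup_const//; exists 0%N.
- by move=> _ [n [B [mB ->]]]; exact: m12.
Qed.

End product_law.

(** * Independence of the first step and the one-step Markov property *)

Section walk_law.
Context {R : realType} {N : nat}.
Variables (lam : {measure set (RN R N) -> \bar R}) (hlam : is_lebesgue_RN lam).
Variables (P : probability (Omega R N) R) (hP : is_ball_product lam P).
Local Open Scope ereal_scope.

(** Bundled as a measurable function so that [distribution P first_step], the law of [w 0], is a
    probability measure. *)
Definition first_step : {mfun (Omega R N) >-> RN R N} :=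
  HB.pack (fun w : Omega R N => w 0%N : RN R N)
    (isMeasurableFun.Build _ _ _ _ _ (@measurable_coordO R N 0)).

Lemma cylinderE n (A : nat -> set (RN R N)) : (forall i, measurable (A i)) ->
  P (cylinder n A) = (\prod_(i < n) (fine (lam (A i `&` euc_ball 0 1)) / vol lam))%R%:E.
Proof. exact: hP. Qed.

Lemma first_stepE (A : set (RN R N)) : measurable A ->
  distribution P first_step A = (fine (lam (A `&` euc_ball 0 1)) / vol lam)%:E.
Proof.
move=> mA; have := @cylinderE 1 (fun=> A) (fun=> mA).
rewrite big_ord1 => <-; congr (P _).
by rewrite predeqE => w; split => [wA [|//] _|/(_ 0%N)]; last exact.
Qed.

(** For fixed [A] both sides are finite measures in [B]. On a cylinder, prepending [A] gives a
    cylinder one longer, and the product formula splits off its first factor. *)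
Lemma shift_lawE (A : set (RN R N)) (B : set (Omega R N)) : measurable A -> measurable B ->
  P [set w | A (w 0%N) /\ B (Omega_shift w)] = distribution P first_step A * P B.
Proof.
move=> mA mB.
have mA0 : measurable ([set w | A (w 0%N)] : set (Omega R N)).
  by rewrite -[X in measurable X]setTI; exact: (measurable_coordO 0).
have PA : distribution P first_step A \is a fin_num by rewrite fin_num_measure.
pose k : {nonneg R} := NngNum (fine_ge0 (measure_ge0 (distribution P first_step) A)).
have -> : P [set w | A (w 0%N) /\ B (Omega_shift w)] =
    image_measure (mrestr P mA0) measurable_shift B.
  by rewrite /= /pushforward /mrestr; congr (P _); rewrite predeqE => w /=; tauto.
rewrite [RHS](_ : _ = mscale k P B); last by rewrite /mscale/= fineK.
apply: Omega_measure_unique => // [n C mC|]; last first.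
  rewrite /= /pushforward /mrestr preimage_setT setTI.
  by rewrite -ge0_fin_numE// fin_num_measure.
rewrite /= /pushforward /mscale/= fineK//.
pose C' i := if i is j.+1 then C j else A.
have mC' i : measurable (C' i) by case: i => /=.
rewrite first_stepE// cylinderE// -EFinM.
transitivity (P (cylinder n.+1 C')).
  rewrite /mrestr; congr (P _); rewrite predeqE => w; split => [[wC wA] [|i]//= |wC].
    by rewrite ltnS; exact: wC.
  split; last exact: (wC 0%N).
  by move=> i il; exact: (wC i.+1).
by rewrite cylinderE// big_ord_recl.
Qed.

Lemma measurable_first_shift :
  measurable_fun setT (fun w : Omega R N => (w 0%N, Omega_shift w) : RN R N * Omega R N).
Proof.
by apply: measurable_fun_pair; [exact: measurable_coordO|exact: measurable_shift].
Qed.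

(** By [shift_lawE] the law of the pair agrees with the product measure on rectangles, hence
    everywhere; Tonelli then gives the iterated integral. *)
Lemma ge0_integral_first_shift (f : RN R N * Omega R N -> \bar R) :
  measurable_fun setT f -> (forall z, 0 <= f z) ->
  \int[P]_w f (w 0%N, Omega_shift w) =
  \int[distribution P first_step]_a \int[P]_w f (a, w).
Proof.
move=> mf f0.
transitivity (\int[image_measure P measurable_first_shift]_z f z).
  by rewrite ge0_integral_image.
rewrite -fubini_tonelli1//; apply: eq_measure_integral => A mA _.
apply/esym; apply: product_measure_unique => //= B C mB mC.
exact: shift_lawE.
Qed.

Lemma ge0_integral_first_step (g : RN R N -> \bar R) :
  measurable_fun setT g -> (forall z, 0 <= g z) ->
  \int[distribution P first_step]_a g a =
  (vol lam)^-1%:E * \int[lam]_(a in euc_ball 0 1) g a.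
Proof.
move=> mg g0.
have v0 : (0 <= (vol lam)^-1)%R by rewrite invr_ge0 ltW// vol_gt0.
have mB := @measurable_euc_ball R N 0%R 1%R.
rewrite -(@ge0_integral_mrestr _ _ _ lam _ mB)//.
rewrite (_ : ((vol lam)^-1)%R = (NngNum v0)%:num)%R//.
rewrite -ge0_integral_mscale//; apply: eq_measure_integral => A mA _.
transitivity (distribution P first_step A); first by [].
rewrite first_stepE// [RHS]/= /mscale/= /mrestr mulrC EFinM fineK//.
rewrite ge0_fin_numE//; apply: le_lt_trans (lebesgue_unit_ball_lty hlam).
by apply: le_measure; rewrite ?inE//; exact: measurableI.
Qed.

(** The Markov property. Since [f] takes a point and a driving sequence, it applies both to
    upcrossing counts and to the limiting payoff. *)
Lemma one_step (f : RN R N * Omega R N -> \bar R) (x : 'rV[R]_N) (s : R) :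
  measurable_fun setT f -> (forall z, 0 <= f z) ->
  \int[P]_w f ((x + s *: w 0%N)%R, Omega_shift w) =
  (vol lam)^-1%:E * \int[lam]_(a in euc_ball 0 1) \int[P]_w f ((x + s *: (a : 'rV[R]_N))%R, w).
Proof.
move=> mf f0.
pose g (z : RN R N * Omega R N) := f ((x + s *: (z.1 : 'rV[R]_N))%R, z.2).
have mg : measurable_fun setT g.
  apply: (measurableT_comp mf); apply: measurable_fun_pair => //.
  exact: (measurableT_comp (measurable_affine s x)).
rewrite (ge0_integral_first_shift mg)//.
rewrite ge0_integral_first_step//.
  exact: (@measurable_fun_fubini_tonelli_F _ _ _ _ _ P g mg (fun z => f0 _)).
  by move=> a; apply: integral_ge0 => w _; exact: f0.
by move=> z; exact: f0.
Qed.

End walk_law.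

(** * The walk in a bounded open set *)

Lemma continuous_euc_dist (R : realType) (N : nat) (A : set 'rV[R]_N) : A !=set0 ->
  continuous (fun x : 'rV[R]_N => euc_dist x A).
Proof.
move=> A0 x.
have H e : 0 < e -> \forall y \near (x : 'rV[R]_N), `|euc_dist x A - euc_dist y A| < e.
  move=> e0; have /cvgrPdist_lt /(_ _ e0) := @euc_norm_continuous R N 0.
  rewrite euc_norm0 => /nbhs_ballP[d /= d0 dP].
  apply/nbhs_ballP; exists d => //= y xy.
  apply: (le_lt_trans (abs_euc_distB x y A0)).
  have /= := dP (x - y).
  rewrite sub0r normrN ger0_norm ?euc_norm_ge0//; apply.
  by move: xy; rewrite !mx_norm_ball /ball_/= sub0r normrN.
by move/cvgrPdist_lt: H.
Qed.

Section domain.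
Context {R : realType} {N : nat} (hN : (0 < N)%N).
Variables (D : set 'rV[R]_N) (hDo : open D) (hDb : bounded_set D).
Implicit Types (x y z : 'rV[R]_N).

Lemma bdry_open : bdry D = closure D `\` D.
Proof. by rewrite /bdry; have /interior_id -> := hDo. Qed.

Lemma closed_bdry : closed (bdry D).
Proof. by apply: closedI; [exact: closed_closure|exact: open_closedC (@open_interior _ _)]. Qed.

(** If the segment from [x] to [y] missed the boundary, the parameters with image in [D] would form
    a relatively open and closed nonempty part of [[0, 1]], hence all of it. A point of the segment
    is no farther from [x] than [y] is. *)
Lemma bdry_crossing x y : D x -> ~ D y ->
  exists2 z, bdry D z & euc_norm (x - z) <= euc_norm (x - y).
Proof.
move=> Dx Dy; apply: contrapT => nz.
pose f (t : R) : 'rV[R]_N := x + t *: (y - x).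
have cf : continuous f.
  move=> t; apply: (@continuousD R 'rV[R]_N R (cst x) (fun t => t *: (y - x))).
    exact: cst_continuous.
  exact: scalel_continuous.
have /(_ (`[0, 1] `&` f @^-1` D)) H := @segment_connected R 0 1.
have E : `[0, 1] `&` f @^-1` D = `[0, 1]%classic.
  apply: H.
  - by exists 0; split; rewrite /= ?in_itv/= ?lexx ?ler01// /f scale0r addr0.
  - by exists (f @^-1` D) => //; apply: open_comp => // ? _; exact: cf.
  - exists (f @^-1` closure D).
      by apply: closed_comp => [? _|]; [exact: cf|exact: closed_closure].
    rewrite predeqE => t; split => [[t01 Dft]|[t01 cDft]]; split => //.
      exact: subset_closure.
    apply: contrapT => nDft; apply: nz; exists (f t); first by rewrite bdry_open.
    have -> : x - f t = t *: (x - y) by rewrite /f opprD addNKr -scalerN opprB.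
    move: t01; rewrite /= in_itv/= => /andP[t0 t1].
    by rewrite euc_normZ ger0_norm// ler_piMl// euc_norm_ge0.
have [_] : (`[0, 1] `&` f @^-1` D) 1 by rewrite E /= in_itv/= lexx ler01.
by rewrite /f/= scale1r addrCA subrr addr0.
Qed.

(** A constant vector larger than the bound of [D] lies outside [D]; [0 < N] provides a coordinate
    to see it. An empty boundary would give [euc_dist] the default value 0 and freeze the walk. *)
Lemma bdry_nonempty x : D x -> bdry D !=set0.
Proof.
move=> Dx.
have [M [_ /(_ (M + 1)) HM]] := hDb.
have M1 : M < M + 1 by rewrite ltrDl.
pose y : 'rV[R]_N := const_mx (`|M + 1| + 1).
have nDy : ~ D y.
  move=> /(HM M1)/= yM; have := coord_le_norm y (Ordinal hN); rewrite mxE.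
  rewrite ger0_norm ?addr_ge0// => /le_trans/(_ yM).
  by have := ler_norm (M + 1); lra.
by have [z Bz _] := bdry_crossing Dx nDy; exists z.
Qed.

Variables (eps : R) (heps : 0 < eps < 1).

Definition step x : R := Num.min eps (euc_dist x (bdry D)).

Lemma step_gt0 x : D x -> 0 < step x.
Proof.
move=> Dx; have /andP[e0 _] := heps; rewrite lt_min e0/=.
have /nbhs_ballP[d /= d0 dD] : nbhs x D by apply: open_nbhs_nbhs.
apply: (lt_le_trans d0); apply: le_euc_dist; first exact: bdry_nonempty Dx.
rewrite bdry_open => z [_ nDz]; rewrite leNgt; apply/negP => xz; apply/nDz/dD.
by rewrite mx_norm_ball /ball_/=; apply: le_lt_trans xz; exact: norm_le_euc_norm.
Qed.

Lemma ball_sub_domain x y : D x -> euc_norm (x - y) < step x -> D y.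
Proof.
move=> Dx xy; apply: contrapT => nDy.
have [z Bz xz] := bdry_crossing Dx nDy.
move: xy; rewrite lt_min => /andP[_]; apply/negP; rewrite -leNgt.
by apply: le_trans xz; exact: euc_dist_le.
Qed.

Lemma euc_ball_sub_domain x : D x -> euc_ball x (step x) `<=` D.
Proof.
by move=> Dx y xy; apply: (ball_sub_domain Dx); rewrite euc_distC.
Qed.

Lemma step_in_domain x a : D x -> euc_ball 0 1 a -> D (x + step x *: a).
Proof.
move=> Dx; rewrite /euc_ball/= subr0 => a1; apply: (ball_sub_domain Dx).
rewrite opprD addNKr euc_normN euc_normZ gtr0_norm ?step_gt0//.
by rewrite gtr_pMr// step_gt0.
Qed.

Lemma continuous_step : bdry D !=set0 -> continuous step.
Proof.
move=> B0 x; rewrite /step.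
apply: (@continuous_min R _ (cst eps) (fun x => euc_dist x (bdry D))); first exact: cst_continuous.
exact: continuous_euc_dist.
Qed.

Lemma measurable_step : bdry D !=set0 -> measurable_fun setT (step : RN R N -> R).
Proof. by move=> /continuous_step; exact: continuous_measurable_RN. Qed.

(** The definition appends the last step, whereas the Markov property peels off the first. *)
Lemma ball_walk_recl x w n : ball_walk D eps x w n.+1 =
  ball_walk D eps (x + step x *: w 0%N) (Omega_shift w) n.
Proof.
elim: n => [//|n IH].
transitivity (ball_walk D eps x w n.+1 + step (ball_walk D eps x w n.+1) *: w n.+1) => //.
by rewrite IH.
Qed.

Lemma ball_walk_domain x w : D x -> (forall n, euc_ball 0 1 (w n)) ->
  forall n, D (ball_walk D eps x w n).
Proof.
by move=> Dx wB; elim=> [//|n IH]; apply: step_in_domain.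
Qed.

(** Measurability is joint because Tonelli also integrates over the starting point. *)
Lemma measurable_ball_walk n : bdry D !=set0 ->
  measurable_fun setT (fun z : RN R N * Omega R N => ball_walk D eps z.1 z.2 n : RN R N).
Proof.
move=> B0; elim: n => [|n IH]; first exact: measurable_fst.
apply: measurable_fun_RN => i /=.
rewrite (_ : (fun _ => _) = (fun z : RN R N * Omega R N =>
    ball_walk D eps z.1 z.2 n ord0 i + step (ball_walk D eps z.1 z.2 n) * z.2 n ord0 i)); last first.
  by apply/funext => z; rewrite !mxE.
apply: measurable_funD; first exact: (measurableT_comp (measurable_coord i) IH).
apply: measurable_funM; first exact: (measurableT_comp (measurable_step B0) IH).
apply: (measurableT_comp (measurable_coord i)).
exact: (measurableT_comp (@measurable_coordO R N n) measurable_snd).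
Qed.

End domain.

(** * Almost sure convergence *)

Section upcrossings.
Context {R : realType} (a b : R).

(* Number of upcrossings of [a, b] among the first [m] terms of [y]; the flag
   is [true] once a value [<= a] has been seen and a value [>= b] is awaited. *)
Fixpoint upcrossings (m : nat) (s : bool) (y : nat -> R) : nat :=
  if m is m'.+1 then
    let y' := fun n => y n.+1 in
    if s then if b <= y 0%N then (upcrossings m' false y').+1 else upcrossings m' true y'
    else upcrossings m' (y 0%N <= a) y'
  else 0%N.

Lemma upcrossings_leS m s y : (upcrossings m s y <= upcrossings m.+1 s y)%N.
Proof.
elim: m s y => [//|m IH] s y.
rewrite [X in (X <= _)%N]/= [X in (_ <= X)%N]/=.
case: s; last exact: IH.
by case: ifP => _; [rewrite ltnS|]; exact: IH.
Qed.

(** Induction on [K]; an inner induction on the index of the next value [>= b], or [<= a], runs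
    forward until the flag changes. *)
Lemma upcrossings_unbounded (y : nat -> R) K s :
  (forall n, (exists2 k, (n <= k)%N & y k <= a) /\ (exists2 k, (n <= k)%N & b <= y k)) ->
  exists m, (K <= upcrossings m s y)%N.
Proof.
pose osc (z : nat -> R) :=
  forall n, (exists2 k, (n <= k)%N & z k <= a) /\ (exists2 k, (n <= k)%N & b <= z k).
have oscS z : osc z -> osc (fun n => z n.+1).
  move=> oz n; have [[[//|k] nk ak] [[//|l] nl bl]] := oz n.+1.
  by split; [exists k|exists l].
rewrite -/(osc y); elim: K s y => [|K IH] s y oy; first by exists 0%N.
have up z : osc z -> exists m, (K < upcrossings m true z)%N.
  move=> oz; have [_ [k _ bk]] := oz 0%N.
  elim: k z oz bk => [|k IHk] z oz bk; have [bz|bz] := boolP (b <= z 0%N).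
  - by have [m Km] := IH false _ (oscS _ oz); exists m.+1; rewrite /= bz.
  - by rewrite bk in bz.
  - by have [m Km] := IH false _ (oscS _ oz); exists m.+1; rewrite /= bz.
  - by have [m Km] := IHk _ (oscS _ oz) bk; exists m.+1; rewrite /= (negbTE bz).
case: s; first exact: up.
have [[k _ ak] _] := oy 0%N.
elim: k y oy ak => [|k IHk] y oy ak; have [ay|ay] := boolP (y 0%N <= a).
- by have [m Km] := up _ (oscS _ oy); exists m.+1; rewrite /= ay.
- by rewrite ak in ay.
- by have [m Km] := up _ (oscS _ oy); exists m.+1; rewrite /= ay.
- by have [m Km] := IHk _ (oscS _ oy) ak; exists m.+1; rewrite /= (negbTE ay).
Qed.

Lemma measurable_upcrossings d (T : measurableType d) m s (y : nat -> T -> R) :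
  (forall n, measurable_fun setT (y n)) ->
  measurable_fun setT (fun t => (upcrossings m s (y ^~ t))%:R : R).
Proof.
elim: m s y => [|m IH] s y my /=; first exact: measurable_cst.
have H s' : measurable_fun setT (fun t => (upcrossings m s' (fun n => y n.+1 t))%:R : R).
  exact: (IH s' (fun n => y n.+1)).
case: s.
  rewrite (_ : (fun _ => _) = (fun t => if b <= y 0%N t
    then (upcrossings m false (fun n => y n.+1 t))%:R + 1
    else (upcrossings m true (fun n => y n.+1 t))%:R)); last first.
    by apply/funext => t; case: ifP => _; rewrite ?natr1.
  apply: measurable_fun_ifT; [exact: measurable_fun_ler|exact: measurable_funD|exact: H].
rewrite (_ : (fun _ => _) = (fun t => if y 0%N t <= a
    then (upcrossings m true (fun n => y n.+1 t))%:R
    else (upcrossings m false (fun n => y n.+1 t))%:R)); last first.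
  by apply/funext => t; case: ifP.
by apply: measurable_fun_ifT; [exact: measurable_fun_ler|exact: H|exact: H].
Qed.

End upcrossings.

(** Rationals strictly between a lower limit and a larger upper limit would be crossed infinitely
    often. As [y] is nonnegative, so is its lower limit, and only [a >= 0] is ever tested. *)
Lemma cvg_finite_upcrossings (R : realType) (y : nat -> R) (M : R) :
  (forall n, 0 <= y n <= M) ->
  (forall a b : rat, 0 <= ratr a :> R -> ratr a < ratr b :> R ->
     exists K, forall m, (upcrossings (ratr a) (ratr b) m false y <= K)%N) ->
  cvgn y.
Proof.
move=> yM yK.
pose ye n := (y n)%:E.
have le0 n : (0 <= einfs ye n)%E.
  by apply: le_ereal_inf_tmp => _ [k _ <-]; rewrite lee_fin; have /andP[] := yM k.
have leM n : (esups ye n <= M%:E)%E.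
  by apply: ub_ereal_sup => _ [k _ <-]; rewrite lee_fin; have /andP[] := yM k.
have lu : limn_einf ye = limn_esup ye.
  apply/eqP; rewrite eq_le limn_einf_sup/= leNgt; apply/negP => lt_lu.
  have l0 : (0 <= limn_einf ye)%E.
    by rewrite limn_einf_lim; apply: lime_ge; [exact: is_cvg_einfs|exact: nearW].
  have uM : (limn_esup ye <= M%:E)%E.
    by rewrite limn_esup_lim; apply: lime_le; [exact: is_cvg_esups|exact: nearW].
  have ufin : limn_esup ye \is a fin_num.
    by rewrite ge0_fin_numE ?(le_lt_trans uM) ?ltry// (le_trans l0)// ltW.
  have lfin : limn_einf ye \is a fin_num.
    by rewrite ge0_fin_numE// (lt_le_trans lt_lu)// leey.
  have := lt_lu; rewrite -(fineK ufin) -(fineK lfin) lte_fin => lt'.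
  have [a] := rat_in_itvoo lt'; rewrite in_itv/= => /andP[la au].
  have [b] := rat_in_itvoo au; rewrite in_itv/= => /andP[ab bu].
  have [] := yK a b _ ab.
    by rewrite (le_trans _ (ltW la))// fine_ge0.
  move=> K yKm.
  have [|m] := @upcrossings_unbounded R (ratr a) (ratr b) y K.+1 false.
    move=> n; split.
      have : (einfs ye n < (ratr a)%:E)%E.
        apply: (@le_lt_trans _ _ (limn_einf ye)); last by rewrite -(fineK lfin) lte_fin.
        rewrite limn_einf_lim (cvg_lim _ (@cvg_einfs_sup R ye))//.
        by apply: ereal_sup_ubound; exists n.
      by move=> /ereal_inf_lt[_ [k /= nk <-]]; rewrite lte_fin => /ltW ?; exists k.
    have : ((ratr b)%:E < esups ye n)%E.
      apply: (@lt_le_trans _ _ (limn_esup ye)); first by rewrite -(fineK ufin) lte_fin.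
      rewrite limn_esup_lim (cvg_lim _ (@cvg_esups_inf R ye))//.
      by apply: ereal_inf_lbound; exists n.
    by move=> /ereal_sup_gt[_ [k /= nk <-]]; rewrite lte_fin => /ltW ?; exists k.
  by rewrite ltnNge yKm.
have ul : ye @ \oo --> limn_esup ye.
  apply: (@squeeze_cvge _ _ _ _ (einfs ye) ye (esups ye)).
  - apply: nearW => n; apply/andP; split.
      by apply: ereal_inf_lbound; exists n => /=.
    by apply: ereal_sup_ubound; exists n => /=.
  - by rewrite -lu limn_einf_lim; exact: is_cvg_einfs.
  - by rewrite limn_esup_lim; exact: is_cvg_esups.
have ufin : limn_esup ye \is a fin_num.
  rewrite ge0_fin_numE; last first.
    by rewrite limn_esup_lim; apply: lime_ge; [exact: is_cvg_esups|apply: nearW => n];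
      rewrite (le_trans (le0 n))// einfs_le_esups.
  rewrite (@le_lt_trans _ _ M%:E) ?ltry//.
  by rewrite limn_esup_lim; apply: lime_le; [exact: is_cvg_esups|exact: nearW].
apply/cvg_ex; exists (fine (limn_esup ye)).
by move: ul; rewrite -{1}(fineK ufin) => /fine_cvgP[].
Qed.

(** * Doob's bound for the coordinates and convergence to the boundary *)

Section walk_convergence.
Context {R : realType} {N : nat} (hN : (0 < N)%N).
Variables (lam : {measure set (RN R N) -> \bar R}) (hlam : is_lebesgue_RN lam).
Variables (P : probability (Omega R N) R) (hP : is_ball_product lam P).
Variables (D : set 'rV[R]_N) (hDo : open D) (hDb : bounded_set D).
Variables (eps : R) (heps : 0 < eps < 1).
Implicit Types (x y z : 'rV[R]_N).

Local Notation rho := (step D eps).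
Local Notation walk := (ball_walk D eps).

(* Affine functions are harmonic for the walk, hence an affine bound on the mean
   of [F] in terms of the starting point survives one step. *)
Lemma one_step_le (F : RN R N * Omega R N -> \bar R) (c s : R) (i : 'I_N) :
  measurable_fun setT F -> (forall p, 0 <= F p)%E ->
  (forall y, D y -> 0 <= c + s * y ord0 i) ->
  (forall y, D y -> \int[P]_w F (y, w) <= (c + s * y ord0 i)%:E)%E ->
  forall x, D x ->
  (\int[P]_w F ((x + rho x *: w 0%N)%R, Omega_shift w) <= (c + s * x ord0 i)%:E)%E.
Proof.
move=> mF F0 cs0 FE x Dx.
have mB := @measurable_euc_ball R N 0 1.
have v0 : 0 < vol lam by apply: vol_gt0.
rewrite (one_step hlam hP)//.
(* The affine bound at [x] is its own mean over the ball, which allows a pointwise comparison under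
   the integral. *)
have -> : (c + s * x ord0 i)%:E = ((vol lam)^-1%:E *
    \int[lam]_(a in euc_ball 0 1) ((c + s * x ord0 i) + (s * rho x) * (a : 'rV[R]_N) ord0 i)%:E)%E.
  rewrite (integral_unit_ball_coord hlam) => [|a aB].
    by rewrite -EFinM; congr EFin; field; rewrite gt_eqF.
  have := cs0 _ (step_in_domain hN hDo hDb heps Dx aB).
  by rewrite !mxE mulrDr addrA mulrA.
apply: lee_wpmul2l; first by rewrite lee_fin invr_ge0 ltW.
have mG := @measurable_fun_fubini_tonelli_F _ _ _ _ _ P F mF F0.
apply: ge0_le_integral => //.
- by move=> a _; apply: integral_ge0.
- apply: measurable_funS measurableT _ _ => //.
  exact: (measurableT_comp mG (measurable_affine (rho x) x)).
- apply: measurable_funS measurableT _ _ => //.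
  apply/measurable_EFinP; apply: measurable_funD => //; apply: measurable_funM => //.
  exact: measurable_coord.
- move=> a aB; apply: (le_trans (FE _ (step_in_domain hN hDo hDb heps Dx aB))).
  by rewrite lee_fin !mxE mulrDr addrA mulrA.
Qed.

Lemma measurable_walk_coord n (M : R) (i : 'I_N) : bdry D !=set0 ->
  measurable_fun setT (fun p : RN R N * Omega R N => M + walk p.1 p.2 n ord0 i).
Proof.
move=> B0; apply: measurable_funD => //.
exact: (measurableT_comp (measurable_coord i) (measurable_ball_walk eps n B0)).
Qed.

(** The price is the coordinate translated by [M] to be nonnegative on [D]; each upcrossing earns at
    least [b - a]. *)
Definition scaled_upcrossings (a b M : R) (i : 'I_N) m s (p : RN R N * Omega R N) : \bar R :=
  ((b - a) * (upcrossings a b m s (fun n => M + walk p.1 p.2 n ord0 i))%:R)%:E.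

Section upcrossings_bound.
Variables (a b M : R) (i : 'I_N) (a0 : 0 <= a) (ab : a < b).
Hypothesis M0 : forall y, D y -> 0 <= M + y ord0 i.
Local Notation U := (scaled_upcrossings a b M i).

Lemma measurable_scaled_upcrossings m s : bdry D !=set0 -> measurable_fun setT (U m s).
Proof.
move=> B0; apply/measurable_EFinP; apply: measurable_funM => //.
apply: (@measurable_upcrossings R a b _ _ m s
  (fun n (p : RN R N * Omega R N) => M + walk p.1 p.2 n ord0 i)) => n.
exact: measurable_walk_coord.
Qed.

Lemma scaled_upcrossings_ge0 m s p : (0 <= U m s p)%E.
Proof. by rewrite lee_fin mulr_ge0// subr_ge0 ltW. Qed.

(* Doob's upcrossing inequality, by induction on the horizon: a strategy that
   buys below [a] and sells above [b] has fair value at most [a] when idle and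
   at most the current price when holding. *)
Lemma upcrossings_bound m s x : D x ->
  (\int[P]_w U m s (x, w) <= (if s then M + x ord0 i else a)%:E)%E.
Proof.
elim: m s x => [|m IH] s x Dx.
  under eq_integral do rewrite /scaled_upcrossings/= mulr0.
  by rewrite integral0 lee_fin; case: s => //; exact: M0.
have B0 := bdry_nonempty hN hDo hDb Dx.
(* [V] counts along the walk restarted after one step, the tail inspected by the recursion of
   [upcrossings]. *)
pose V s' (w : Omega R N) := U m s' (x + rho x *: w 0%N, Omega_shift w).
have VE s' : (\int[P]_w V s' w <= (if s' then M + x ord0 i else a)%:E)%E.
  have mU := measurable_scaled_upcrossings m s' B0.
  have U0 := scaled_upcrossings_ge0 m s'.
  case: s' mU U0 => mU U0.
    rewrite -[x ord0 i]mul1r; apply: one_step_le => //= y Dy; rewrite mul1r ?M0//.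
    exact: (IH true).
  (* The constant [a] is treated as an affine function of slope 0. *)
  rewrite -[a in X in (_ <= X)%E]addr0 -[0 in X in (_ <= X)%E](mul0r (x ord0 i)).
  apply: one_step_le => //= y Dy; rewrite mul0r addr0//.
  exact: (IH false).
have UE w : U m.+1 s (x, w) =
    if s then if b <= M + x ord0 i then ((b - a)%:E + V false w)%E else V true w
    else V (M + x ord0 i <= a) w.
  rewrite /V /scaled_upcrossings/=.
  have -> : (fun n => M + (walk x w n + Num.min eps (euc_dist (walk x w n) (bdry D)) *: w n) ord0 i) =
      (fun n => M + walk (x + rho x *: w 0%N) (Omega_shift w) n ord0 i).
    by apply/funext => n; rewrite -ball_walk_recl.
  case: s => //; case: ifP => // _.
  by rewrite -EFinD; congr EFin; rewrite -natr1; ring.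
under eq_integral do rewrite UE.
case: s UE => UE; last first.
  (* When the flag turns to holding, the bound is the current price, which is then at most [a]. *)
  apply: (le_trans (VE _)); case: ifP => //.
have [bx|bx] := leP b (M + x ord0 i); last exact: (VE true).
rewrite ge0_integralD//; last 3 first.
- by rewrite lee_fin subr_ge0 ltW.
- by move=> w _; exact: scaled_upcrossings_ge0.
- apply: (@measurableT_comp _ _ _ _ _ _ (U m false) _
    (fun w : Omega R N => (x + rho x *: w 0%N : RN R N, Omega_shift w))).
    exact: measurable_scaled_upcrossings.
  apply: measurable_fun_pair; last exact: measurable_shift.
  exact: (measurableT_comp (measurable_affine (rho x) x) (@measurable_coordO R N 0)).
have -> : (\int[P]_(_ in [set: Omega R N]) (b - a)%:E = (b - a)%:E)%E.
  by rewrite integral_cst// [X in (_ * X)%E]probability_setT mule1.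
(* The gain [b - a] and the idle value [a] add up to [b], at most the current price. *)
apply: (@le_trans _ _ ((b - a)%:E + a%:E)%E).
  by apply: leeD2l; exact: (VE false).
by rewrite -EFinD lee_fin subrK.
Qed.

(** The bound [a] does not depend on the horizon, so by monotone convergence the limiting count is
    integrable, hence almost surely finite. *)
Lemma ae_finite_upcrossings x : D x -> {ae P, forall w : Omega R N, exists K,
  forall m, (upcrossings a b m false (fun n => M + walk x w n ord0 i)%R <= K)%N}.
Proof.
move=> Dx; have B0 := bdry_nonempty hN hDo hDb Dx.
pose g m (w : Omega R N) := U m false (x, w).
have mg m : measurable_fun setT (g m).
  apply: (measurableT_comp (measurable_scaled_upcrossings m false B0)).
  exact: measurable_pair1.
have g0 m w : (0 <= g m w)%E by exact: scaled_upcrossings_ge0.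
have gS w : {homo g ^~ w : n m / (n <= m)%N >-> (n <= m)%E}.
  apply: homo_leq => [//|? ? ?|n]; first exact: le_trans.
  rewrite /g /scaled_upcrossings lee_fin ler_wpM2l// ?ler_nat ?upcrossings_leS//.
  by rewrite subr_ge0 ltW.
have Lsup w : limn (g ^~ w) = ereal_sup (range (g ^~ w)).
  by apply: cvg_lim => //; exact: ereal_nondecreasing_cvgn.
have mL : measurable_fun setT (fun w => limn (g ^~ w)).
  apply: (emeasurable_fun_cvg g) => // w _.
  by apply: ereal_nondecreasing_is_cvgn.
have iL : P.-integrable setT (fun w => limn (g ^~ w)).
  apply/integrableP; split => //.
  have -> : (\int[P]_w `|limn (g ^~ w)| = \int[P]_w limn (g ^~ w))%E.
    apply: eq_integral => w _; rewrite gee0_abs// Lsup.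
    by apply: (le_trans (g0 0%N w)); apply: ereal_sup_ubound; exists 0%N.
  rewrite monotone_convergence//; apply: (@le_lt_trans _ _ a%:E); last exact: ltry.
  apply: lime_le.
    apply: ereal_nondecreasing_is_cvgn => n m nm.
    by apply: ge0_le_integral => // w _; exact: gS.
  by apply: nearW => m; exact: (upcrossings_bound m false Dx).
have := integrable_ae measurableT iL; apply: filterS => w /(_ I) Lfin.
exists (Num.truncn (fine (limn (g ^~ w)) / (b - a))).+1 => m.
rewrite -(@ler_nat R) ltW// (le_lt_trans _ (truncnS_gt _))//.
rewrite ler_pdivlMr ?subr_gt0// mulrC -lee_fin fineK// Lsup.
by apply: ereal_sup_ubound; exists m.
Qed.

End upcrossings_bound.

Lemma P_coord_unit_ball n : P [set w : Omega R N | euc_ball 0 1 (w n)] = 1%E.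
Proof.
have mB := @measurable_euc_ball R N 0 1.
have v0 : 0 < vol lam by apply: vol_gt0.
transitivity (P (cylinder n.+1 (fun i => if i == n then euc_ball 0 1 else setT))).
  congr (P _); rewrite predeqE => w; split => [wB i _|/(_ n (ltnSn n))]; last by rewrite eqxx.
  by case: ifP => // /eqP ->.
rewrite (cylinderE hP); last by move=> i; case: ifP.
rewrite big1// => i _; case: ifP => _; rewrite ?setIid ?setTI -/(vol lam) divff// gt_eqF//.
Qed.

Lemma ae_unit_ball : {ae P, forall w : Omega R N, forall n, euc_ball 0 1 (w n)}.
Proof.
apply/ae_foralln => n.
have mS : measurable ([set w | euc_ball 0 1 (w n)] : set (Omega R N)).
  rewrite -[X in measurable X]setTI.
  by apply: (measurable_coordO n) => //; exact: measurable_euc_ball.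
exists (~` [set w : Omega R N | euc_ball 0 1 (w n)]); split => //.
  exact: measurableC.
by rewrite [LHS]probability_setC// P_coord_unit_ball subee.
Qed.

(** The event requires in particular [m] given coordinates to lie in the half ball, which has
    probability [(2^-N)^m]; since [0 < N] this tends to 0. *)
Lemma ae_not_eventually_small : {ae P, forall w : Omega R N,
  forall n, ~ forall k, (n <= k)%N -> euc_ball 0 (2^-1) (w k)}.
Proof.
apply/ae_foralln => n.
have mB := @measurable_euc_ball R N 0 1.
have v0 : 0 < vol lam by apply: vol_gt0.
pose S := [set w : Omega R N | forall k, (n <= k)%N -> euc_ball 0 (2^-1) (w k)].
have mS : measurable S.
  rewrite [X in measurable X](_ : _ = \bigcap_(k in [set k | (n <= k)%N])
    (fun w : Omega R N => w k : RN R N) @^-1` euc_ball 0 (2^-1))//.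
  apply: bigcap_measurableType => k _; rewrite -[X in measurable X]setTI.
  by apply: measurable_coordO => //; exact: measurable_euc_ball.
pose q : R := 2^-1 ^+ N.
have q0 : 0 <= q by rewrite exprn_ge0.
have q1 : q < 1 by rewrite exprn_ilt1 -?lt0n//; lra.
have PS m : (P S <= (q ^+ m)%:E)%E.
  pose A (i : nat) : set (RN R N) := if (i < n)%N then setT else euc_ball 0 (2^-1).
  have mA i : measurable (A i) by rewrite /A; case: ifP => // _; exact: measurable_euc_ball.
  apply: (@le_trans _ _ (P (cylinder (n + m) A))).
    apply: le_measure; rewrite ?inE//; first exact: measurable_cylinder.
    move=> w wS i _; rewrite /A; case: ltnP => // ni; exact: wS.
  rewrite (cylinderE hP)// big_split_ord/= lee_fin big1 ?mul1r; last first.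
    by move=> i _; rewrite /A/= ltn_ord setTI -/(vol lam) divff// gt_eqF.
  under eq_bigr => i _.
    rewrite /A/= ltnNge leq_addr/=.
    have -> : euc_ball 0 2^-1 `&` euc_ball 0 1 = euc_ball (0 : 'rV[R]_N) 2^-1.
      apply/setIidPl => y; rewrite /euc_ball/= => /lt_trans; apply; lra.
    rewrite (lebesgue_euc_ballE hlam) ?invr_gt0//= mulfK ?gt_eqF//.
    over.
  by rewrite prodr_const card_ord.
have PS0 : P S = 0%E.
  apply/eqP; rewrite eq_le measure_ge0 andbT.
  have PSf : P S \is a fin_num by rewrite fin_num_measure.
  rewrite -(fineK PSf) lee_fin.
  have : q ^+ m @[m --> \oo] --> 0 by apply: cvg_expr; rewrite ger0_norm.
  move=> /cvgr_to_ge; apply; apply: nearW => m.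
  by rewrite -lee_fin fineK.
by exists S; split => // w /contrapT.
Qed.

Lemma walk_cvg_bdry x w : D x -> (forall n, euc_ball 0 1 (w n)) ->
  (forall i, cvgn (fun n => walk x w n ord0 i)) ->
  (forall n, ~ forall k, (n <= k)%N -> euc_ball 0 (2^-1) (w k)) ->
  exists2 L, bdry D L & walk x w @ \oo --> L.
Proof.
move=> Dx wB cw wn.
have B0 := bdry_nonempty hN hDo hDb Dx.
have DX := ball_walk_domain hN hDo hDb heps Dx wB.
pose L : 'rV[R]_N := \row_i limn (fun n => walk x w n ord0 i).
have XL : walk x w @ \oo --> L.
  apply/cvg_ballP => e e0.
  have : \forall n \near \oo, forall i, ball (L ord0 i) e (walk x w n ord0 i).
    apply: filter_forall => i; rewrite mxE.
    by have /cvg_ballP /(_ _ e0) := cw i.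
  by apply: filterS => n H; split => // j i; rewrite ord1; exact: H.
exists L => //; rewrite bdry_open//; split.
  have cX : \forall n \near \oo, closure D (walk x w n).
    by apply: nearW => n; exact: subset_closure.
  exact: (closed_cvg _ (@closed_closure _ D) cX _ XL).
move=> DL; have rL := step_gt0 hN hDo hDb heps DL.
have rX : rho (walk x w n) @[n --> \oo] --> rho L.
  by apply: (cvg_comp _ _ XL); exact: continuous_step.
have dX : euc_norm (walk x w n.+1 - walk x w n) @[n --> \oo] --> (0 : R).
  have XS : (fun n => walk x w n.+1) @ \oo --> L by rewrite cvg_shiftS.
  rewrite -(@euc_norm0 R N) -(subrr L).
  exact: (cvg_comp _ _ (cvgB XS XL) (@euc_norm_continuous R N (L - L))).
(* A step size above [rho L / 2] and an increment below [rho L / 4] force the norm of [w k] below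
   [1/2]. *)
have [n0 _ H1] : \forall n \near \oo, rho L / 2 < rho (walk x w n).
  by move/cvgr_gt : rX; apply; lra.
have [n1 _ H2] : \forall n \near \oo, euc_norm (walk x w n.+1 - walk x w n) < rho L / 4.
  by move/cvgr_lt : dX; apply; lra.
apply: (wn (maxn n0 n1)) => k; rewrite geq_max => /andP[k0 k1].
have := H1 _ k0; have := H2 _ k1; rewrite /euc_ball/= subr0.
rewrite -/(rho (walk x w k)) addrAC subrr add0r euc_normZ.
rewrite gtr0_norm ?step_gt0//.
move: (rho (walk x w k)) (rho L) rL => u v v0 uv vu.
have u0 : 0 < u by lra.
by rewrite -(ltr_pM2l u0); lra.
Qed.

Lemma ae_walk_cvg x : D x ->
  {ae P, forall w : Omega R N, exists2 L, bdry D L & walk x w @ \oo --> L}.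
Proof.
move=> Dx.
have [M [_ /(_ (M + 1))]] := hDb; rewrite ltrDl => /(_ ltr01) DM.
have {}DM y : D y -> `|y| <= M + 1 by exact: DM.
have Mi y i : D y -> 0 <= (M + 1) + y ord0 i <= 2 * (M + 1).
  move=> /DM yM; have := le_trans (coord_le_norm y i) yM.
  by rewrite ler_norml => /andP[? ?]; apply/andP; split; lra.
(* Pairs of rationals are coded by naturals, so that countably many almost sure statements can be
   intersected. *)
have H i (k : nat) : {ae P, forall w : Omega R N,
    if unpickle k is Some (a, b) then
      0 <= ratr a :> R -> ratr a < ratr b :> R -> exists K,
      forall m, (upcrossings (ratr a) (ratr b) m false
        (fun n => (M + 1) + walk x w n ord0 i)%R <= K)%N
    else True}.
  case: unpickle => [[a b]|]; last by apply: aeW.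
  have [a0|a0] := boolP ((0 : R) <= ratr a); last by apply: aeW.
  have [ab|ab] := boolP ((ratr a : R) < ratr b); last by apply: aeW.
  have := @ae_finite_upcrossings (ratr a) (ratr b) (M + 1) i a0 ab _ x Dx.
  move=> /(_ (fun y Dy => proj1 (andP (Mi y i Dy)))); by apply: filterS.
have {}H : {ae P, forall w : Omega R N, forall i (k : nat),
    if unpickle k is Some (a, b) then
      0 <= ratr a :> R -> ratr a < ratr b :> R -> exists K,
      forall m, (upcrossings (ratr a) (ratr b) m false
        (fun n => (M + 1) + walk x w n ord0 i)%R <= K)%N
    else True}.
  by apply: filter_forall => i; apply/ae_foralln => k; exact: H.
move: H ae_unit_ball ae_not_eventually_small; apply: filterS3 => w Hw wB wn.
apply: walk_cvg_bdry => // i.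
have : cvgn (fun n => (M + 1) + walk x w n ord0 i).
  apply: (@cvg_finite_upcrossings R _ (2 * (M + 1))).
    by move=> n; apply: Mi; exact: ball_walk_domain.
  by move=> a b; have := Hw i (pickle (a, b)); rewrite pickleK.
move=> /cvg_ex[l cl]; apply/cvg_ex; exists (l - (M + 1)).
rewrite (_ : (fun n => _) = (fun n => (M + 1) + walk x w n ord0 i - (M + 1))); last first.
  by apply/funext => n; rewrite addrAC subrr add0r.
by apply: cvgB => //; exact: cvg_cst.
Qed.

End walk_convergence.

(** * The mean value property and continuity *)

Section integral_ae_nonmeasurable.
Context d (T : measurableType d) (R : realType) (mu : {measure set T -> \bar R}).
Local Open Scope ereal_scope.

Let ge0_le_integral_nonmeasurable (f g : T -> \bar R) :
  (forall x, 0 <= f x) -> (forall x, f x <= g x) -> \int[mu]_x f x <= \int[mu]_x g x.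
Proof.
move=> f0 fg; have g0 x : 0 <= g x := le_trans (f0 x) (fg x).
rewrite !ge0_integralTE//; apply: ge_ereal_sup => _ [h hf <-].
by apply: ereal_sup_ubound; exists h => // x; exact: le_trans (hf x) (fg x).
Qed.

(** With [A] the null set, [f] lies between [g] set to 0 on [A] and the same function plus [+oo] on
    [A]; both are measurable with the integral of [g]. *)
Let ge0_ae_eq_integral_nonmeasurable (f g : T -> \bar R) :
  measurable_fun setT g -> (forall x, 0 <= f x) -> (forall x, 0 <= g x) ->
  {ae mu, forall x, f x = g x} -> \int[mu]_x f x = \int[mu]_x g x.
Proof.
move=> mg f0 g0 [A [mA A0 fgA]].
have fgC x : ~ A x -> f x = g x by move=> nAx; apply: contrapT => fgx; apply/nAx/fgA.
have mgA : measurable_fun setT (g \_ (~` A)).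
  apply/(measurable_restrictT _ (measurableC mA)); exact: measurable_funS mg.
have mA' : measurable_fun setT (cst +oo \_ A : T -> \bar R).
  exact/(measurable_restrictT _ mA).
have gA x : ~ A x -> (g \_ (~` A)) x = g x by move=> nAx; rewrite patchE ifT// inE.
apply/eqP; rewrite eq_le; apply/andP; split.
- apply: (@le_trans _ _ (\int[mu]_x ((g \_ (~` A)) x + (cst +oo \_ A) x))).
    apply: ge0_le_integral_nonmeasurable => // x.
    have [Ax|Ax] := pselect (A x).
      rewrite [X in _ + X]patchE ifT ?inE//= [X in X + _]patchE ifF ?add0e ?leey//.
      by apply/negbTE; rewrite notin_setE => /(_ Ax).
    rewrite gA// [X in _ + X]patchE ifF ?adde0 ?fgC//.
    by apply/negbTE; rewrite notin_setE.
  rewrite le_eqVlt; apply/orP; left; apply/eqP; apply: ae_eq_integral => //.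
    exact: emeasurable_funD.
  exists A; split => // x /= nfg; apply: contrapT => nAx; apply: nfg => _.
  rewrite gA// patchE ifF ?adde0//.
  by apply/negbTE; rewrite notin_setE.
- apply: (@le_trans _ _ (\int[mu]_x (g \_ (~` A)) x)).
    rewrite le_eqVlt; apply/orP; left; apply/eqP; apply: ae_eq_integral => //.
    by exists A; split => // x /= nfg; apply: contrapT => nAx; apply: nfg => _; rewrite gA.
  apply: ge0_le_integral_nonmeasurable => x; first by rewrite patchE; case: ifP.
  rewrite patchE; case: ifPn => // /set_mem nAx.
  by rewrite fgC.
Qed.

(* Unlike [ae_eq_integral], [f] is not assumed measurable: the integral is a
   supremum over simple functions below [f], which ignores null sets. *)
Lemma ae_eq_integral_nonmeasurable (f g : T -> \bar R) : measurable_fun setT g ->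
  {ae mu, forall x, f x = g x} -> \int[mu]_x f x = \int[mu]_x g x.
Proof.
move=> mg fg; rewrite integralE [RHS]integralE; congr (_ - _).
- apply: ge0_ae_eq_integral_nonmeasurable => //; first exact: measurable_funepos.
  by move: fg; apply: filterS => x; rewrite !funeposE => ->.
- apply: ge0_ae_eq_integral_nonmeasurable => //; first exact: measurable_funeneg.
  by move: fg; apply: filterS => x; rewrite !funenegE => ->.
Qed.

End integral_ae_nonmeasurable.

Lemma dist_le_sandwich (R : realFieldType) (lo hi p q k : R) :
  lo <= p <= hi -> lo <= q <= hi -> hi <= lo + k -> `|p - q| <= k.
Proof.
by move=> /andP[? ?] /andP[? ?] ?; rewrite ler_norml; apply/andP; split; lra.
Qed.

(** * A measurable version of the payoff and the properties of its mean *)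

Section value_function.
Context {R : realType} {N : nat} (hN : (0 < N)%N).
Variables (lam : {measure set (RN R N) -> \bar R}) (hlam : is_lebesgue_RN lam).
Variables (P : probability (Omega R N) R) (hP : is_ball_product lam P).
Variables (D : set 'rV[R]_N) (hDo : open D) (hDb : bounded_set D).
Variables (F : 'rV[R]_N -> R) (hF : {within bdry D, continuous F}).
Variables (eps : R) (heps : 0 < eps < 1).
Implicit Types (x y z : 'rV[R]_N).

Local Notation rho := (step D eps).
Local Notation walk := (ball_walk D eps).

Lemma bounded_on_bdry : exists2 C, 0 <= C & forall y, bdry D y -> `|F y| <= C.
Proof.
have Bb : bounded_set (bdry D).
  have [M [Mr DM]] := hDb; exists M; split => // M' MM' y [cDy _] /=.
  have cM : closed [set z : 'rV[R]_N | `|z| <= M'].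
    apply: (@closed_comp _ _ (fun z : 'rV[R]_N => `|z|) [set t | t <= M']).
      by move=> z _; exact: norm_continuous.
    exact: closed_le.
  have : closure D `<=` [set z : 'rV[R]_N | `|z| <= M'].
    by rewrite closureE => z; apply; split => // z' Dz'; exact: DM Dz'.
  exact.
have := continuous_compact hF (bounded_closed_compact Bb (@closed_bdry _ _ D)).
move=> /compact_bounded[M [_ FM]]; exists `|M + 1| => // y By.
apply: (le_trans (FM (M + 1) _ (F y) _)); [by rewrite ltrDl|by exists y|exact: ler_norm].
Qed.

(** Continuity within the closed set [bdry D] makes preimages of open rays traces of open sets; off
    [bdry D] the extension is 0. *)
Lemma measurable_bdry_function : measurable_fun setT (F \_ (bdry D) : RN R N -> R).
Proof.
have mB : measurable (bdry D : set (RN R N)).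
  by apply: closed_measurable_RN; exact: closed_bdry.
apply/(measurable_restrictT _ mB).
apply: (measurability _ (RGenOInfty.measurableE R)) => //.
move=> _ [_ [t ->] <-].
have := hF => /continuousP /(_ `]t, +oo[%classic (@rray_open _ _ t)).
move=> /open_subspaceP[V oV VE].
rewrite setIC -VE; apply: measurableI => //; exact: open_measurable_RN.
Qed.

(** A jointly measurable substitute for [walk_limit], equal to it wherever the walk converges. *)
Definition upper_limit (p : RN R N * Omega R N) : RN R N :=
  \row_i fine (limn_esup (fun n => (walk p.1 p.2 n ord0 i)%:E)).

Lemma upper_limit_cvg x w l : walk x w @ \oo --> l -> upper_limit (x, w) = l.
Proof.
move=> xl; apply/rowP => i; rewrite mxE.
have : (walk x w n ord0 i)%:E @[n --> \oo] --> (l ord0 i)%:E.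
  apply: cvg_EFin; first exact: nearW.
  exact: (cvg_comp _ _ xl (@coord_continuous R 1 N ord0 i l)).
by move=> /cvg_limn_einf_sup[_ ->].
Qed.

Lemma measurable_upper_limit : bdry D !=set0 -> measurable_fun setT upper_limit.
Proof.
move=> B0; apply: measurable_fun_RN => i.
rewrite (_ : (fun _ => _) =
    fine \o (fun p => limn_esup (fun n => (walk p.1 p.2 n ord0 i)%:E))); last first.
  by apply/funext => p /=; rewrite mxE.
apply: measurableT_comp; first exact: fine_measurable.
apply: (@measurable_fun_limn_esup _ _ R setT
  (fun n (p : RN R N * Omega R N) => (walk p.1 p.2 n ord0 i)%:E)) => n.
apply/measurable_EFinP.
exact: (measurableT_comp (measurable_coord i) (measurable_ball_walk eps n B0)).
Qed.

Section bounded_payoff.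
Variables (C : R) (C0 : 0 <= C) (FC : forall y, bdry D y -> `|F y| <= C).

(* [F] at the limit point, translated by [C] to be nonnegative so that Tonelli applies. *)
Definition shifted_payoff (p : RN R N * Omega R N) : \bar R :=
  ((F \_ (bdry D)) (upper_limit p) + C)%:E.
Local Notation H := shifted_payoff.

Lemma shifted_payoff_bound p : (0 <= H p <= (2 * C)%:E)%E.
Proof.
have : `|(F \_ (bdry D)) (upper_limit p)| <= C.
  by rewrite patchE; case: ifPn => [/set_mem/FC//|_]; rewrite normr0.
by rewrite !lee_fin ler_norml => /andP[? ?]; apply/andP; split; lra.
Qed.

Lemma shifted_payoff_ge0 p : (0 <= H p)%E.
Proof. by have /andP[] := shifted_payoff_bound p. Qed.

Lemma measurable_shifted_payoff : bdry D !=set0 -> measurable_fun setT H.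
Proof.
move=> B0; apply/measurable_EFinP; apply: measurable_funD => //.
exact: (measurableT_comp measurable_bdry_function (measurable_upper_limit B0)).
Qed.

Definition shifted_value (x : RN R N) : \bar R := (\int[P]_w H (x, w))%E.
Local Notation v := shifted_value.

Lemma measurable_shifted_value : bdry D !=set0 -> measurable_fun setT v.
Proof.
move=> B0; exact: (@measurable_fun_fubini_tonelli_F _ _ _ _ _ P H
  (measurable_shifted_payoff B0) shifted_payoff_ge0).
Qed.

Lemma shifted_value_ge0 x : (0 <= v x)%E.
Proof. by apply: integral_ge0 => w _; exact: shifted_payoff_ge0. Qed.

Lemma shifted_value_le x : bdry D !=set0 -> (v x <= (2 * C)%:E)%E.
Proof.
move=> B0; have -> : (2 * C)%:E = (\int[P]_(_ in [set: Omega R N]) (2 * C)%:E)%E.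
  by rewrite integral_cst// [X in (_ * X)%E]probability_setT mule1.
apply: ge0_le_integral => //.
- by move=> w _; exact: shifted_payoff_ge0.
- by apply: (measurableT_comp (measurable_shifted_payoff B0)); exact: measurable_pair1.
- by move=> w _; have /andP[] := shifted_payoff_bound (x, w).
Qed.

Lemma shifted_value_fin x : bdry D !=set0 -> v x \is a fin_num.
Proof.
move=> B0; rewrite ge0_fin_numE ?shifted_value_ge0//.
by rewrite (le_lt_trans (shifted_value_le x B0))// ltry.
Qed.

(** Almost surely the walk converges to a boundary point, where the original payoff and its
    measurable version coincide. *)
Lemma u_epsE x : D x -> u_eps P D F eps x = fine (v x) - C.
Proof.
move=> Dx; have B0 := bdry_nonempty hN hDo hDb Dx.
pose G (w : Omega R N) := (F \_ (bdry D)) (upper_limit (x, w)).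
have mG : measurable_fun setT G.
  apply: (measurableT_comp measurable_bdry_function).
  by apply: (measurableT_comp (measurable_upper_limit B0)); exact: measurable_pair1.
have GC w : `|G w| <= C.
  by rewrite /G patchE; case: ifPn => [/set_mem/FC//|_]; rewrite normr0.
have iG : P.-integrable setT (EFin \o G).
  apply: measurable_bounded_integrable => //; first by rewrite [ltLHS]probability_setT ltry.
  by exists C; split; [exact: num_real|move=> M CM w _ /=; exact: le_trans (GC w) (ltW CM)].
have iC : P.-integrable [set: Omega R N] (EFin \o cst C).
  by apply: finite_measure_integrable_cst.
have -> : u_eps P D F eps x = fine (\int[P]_w (G w)%:E)%E.
  rewrite /u_eps; congr fine; apply: ae_eq_integral_nonmeasurable; first exact/measurable_EFinP.
  have := ae_walk_cvg hN hlam hP hDo hDb heps Dx; apply: filterS => w [l Bl xl].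
  congr EFin; rewrite /G (upper_limit_cvg xl) patchE ifT ?inE//.
  by rewrite /walk_limit (cvg_lim _ xl)//; exact: norm_hausdorff.
have -> : v x = (\int[P]_w (G w)%:E + C%:E)%E.
  rewrite /v; under eq_integral do rewrite /H EFinD.
  rewrite integralD//=; congr (_ + _)%E.
  by rewrite integral_cst// [X in (_ * X)%E]probability_setT mule1.
have IG : (\int[P]_w (G w)%:E)%E \is a fin_num by apply: integrable_fin_num.
by case: (\int[P]_w (G w)%:E)%E IG => // r _ /=; ring.
Qed.

(** Dropping the first term of the walk does not change its limit. *)
Lemma shifted_value_step x : D x ->
  v x = (\int[P]_w H ((x + rho x *: w 0%N)%R, Omega_shift w))%E.
Proof.
move=> Dx; have B0 := bdry_nonempty hN hDo hDb Dx.
apply: ae_eq_integral_nonmeasurable.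
  apply: (@measurableT_comp _ _ _ _ _ _ H _
      (fun w : Omega R N => (x + rho x *: w 0%N : RN R N, Omega_shift w))).
    exact: measurable_shifted_payoff.
  apply: measurable_fun_pair; last exact: measurable_shift.
  exact: (measurableT_comp (measurable_affine (rho x) x) (@measurable_coordO R N 0)).
have := ae_walk_cvg hN hlam hP hDo hDb heps Dx; apply: filterS => w [l Bl xl].
rewrite /H (upper_limit_cvg xl) (@upper_limit_cvg _ _ l)//.
have -> : walk (x + rho x *: w 0%N) (Omega_shift w) = (fun n => walk x w n.+1).
  by apply/funext => n; rewrite ball_walk_recl.
by rewrite cvg_shiftS.
Qed.

Lemma shifted_value_mean x : D x ->
  (\int[lam]_(y in euc_ball x (rho x)) v y = (rho x ^+ N * vol lam)%:E * v x)%E.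
Proof.
move=> Dx; have B0 := bdry_nonempty hN hDo hDb Dx.
have r0 := step_gt0 hN hDo hDb heps Dx.
have v0 : 0 < vol lam by apply: vol_gt0.
rewrite [X in (_ * X)%E]shifted_value_step// (one_step hlam hP); last 2 first.
- exact: measurable_shifted_payoff.
- exact: shifted_payoff_ge0.
rewrite (ge0_integral_euc_ball hlam)//; last 2 first.
- exact: measurable_shifted_value.
- exact: shifted_value_ge0.
by rewrite muleA -EFinM mulfK ?gt_eqF.
Qed.

(** The averaging ball lies in [D], so the value is [v - C] throughout it, and the constant [C] is
    its own mean. *)
Lemma u_eps_mean x : D x ->
  u_eps P D F eps x = (fine (lam (euc_ball x (rho x))))^-1 *
    fine (\int[lam]_(y in (euc_ball x (rho x) : set (RN R N))) (u_eps P D F eps y)%:E).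
Proof.
move=> Dx; have B0 := bdry_nonempty hN hDo hDb Dx.
have r0 := step_gt0 hN hDo hDb heps Dx.
have v0 : 0 < vol lam by apply: vol_gt0.
have mB := @measurable_euc_ball R N x (rho x).
have mv := measurable_funS measurableT (@subsetT _ _) (measurable_shifted_value B0).
have m0 : 0 < rho x ^+ N * vol lam by rewrite mulr_gt0// exprn_gt0.
have iv : lam.-integrable (euc_ball x (rho x)) v.
  apply/integrableP; split; first exact: mv.
  under eq_integral do rewrite gee0_abs ?shifted_value_ge0//.
  by rewrite shifted_value_mean// -(fineK (shifted_value_fin x B0)) -EFinM ltry.
have iC : lam.-integrable (euc_ball x (rho x)) (fun _ => C%:E).
  apply/integrableP; split => //=.
  by rewrite integral_cst//= [X in (_ * X)%E](lebesgue_euc_ballE hlam)// -EFinM ltry.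
have -> : (\int[lam]_(y in (euc_ball x (rho x) : set (RN R N))) (u_eps P D F eps y)%:E =
    \int[lam]_(y in (euc_ball x (rho x) : set (RN R N))) (v y - C%:E))%E.
  apply: eq_integral => y /set_mem yB.
  rewrite u_epsE; last exact: euc_ball_sub_domain yB.
  by rewrite EFinB fineK// shifted_value_fin.
rewrite integralB// shifted_value_mean// integral_cst// (lebesgue_euc_ballE hlam)//.
rewrite u_epsE// -(fineK (shifted_value_fin x B0)) -!EFinM -EFinB/=.
by rewrite mulrBr [C * _]mulrC !mulKf// gt_eqF.
Qed.

Definition ball_integral x (s : R) : R := fine (\int[lam]_(y in euc_ball x s) v y).

Lemma integral_euc_ball_fin x (s : R) : bdry D !=set0 -> 0 < s ->
  (\int[lam]_(y in euc_ball x s) v y)%E \is a fin_num.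
Proof.
move=> B0 s0; have mB := @measurable_euc_ball R N x s.
have mv := measurable_funS measurableT (@subsetT _ _) (measurable_shifted_value B0).
rewrite ge0_fin_numE; last by apply: integral_ge0 => y _; exact: shifted_value_ge0.
apply: (@le_lt_trans _ _ (\int[lam]_(y in euc_ball x s) (2 * C)%:E)%E).
  apply: ge0_le_integral => //; first by move=> y _; exact: shifted_value_ge0.
  by move=> y _; exact: shifted_value_le.
by rewrite integral_cst// (lebesgue_euc_ballE hlam)// -EFinM ltry.
Qed.

(** The integrals differ by that of [v] over the set difference, where [0 <= v <= 2 * C]. *)
Lemma le_ball_integral x y (s t : R) : bdry D !=set0 -> 0 < s -> 0 < t ->
  euc_ball x s `<=` euc_ball y t ->
  ball_integral x s <= ball_integral y t <=
    ball_integral x s + 2 * C * (vol lam * (t ^+ N - s ^+ N)).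
Proof.
move=> B0 s0 t0 st.
have mS := @measurable_euc_ball R N x s; have mT := @measurable_euc_ball R N y t.
have mD := measurableD mT mS.
have mv := measurable_shifted_value B0.
have If := integral_euc_ball_fin.
have E : (\int[lam]_(z in euc_ball y t) v z = \int[lam]_(z in euc_ball x s) v z +
    \int[lam]_(z in euc_ball y t `\` euc_ball x s) v z)%E.
  rewrite -ge0_integral_setU//.
  - by congr integral; rewrite setDUK.
  - exact: measurable_funS mv.
  - by move=> z _; exact: shifted_value_ge0.
  - by apply/disj_setPS => z [? []].
have lamD : lam (euc_ball y t `\` euc_ball x s) = (vol lam * (t ^+ N - s ^+ N))%:E.
  rewrite measureD//; last by rewrite [ltLHS](lebesgue_euc_ballE hlam)// ltry.
  rewrite setIC (setIidl st) [X in (X - _)%E](lebesgue_euc_ballE hlam)//.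
  by rewrite [X in (_ - X)%E](lebesgue_euc_ballE hlam)// -EFinB; congr EFin; ring.
have J0 : (0 <= \int[lam]_(z in euc_ball y t `\` euc_ball x s) v z)%E.
  by apply: integral_ge0 => z _; exact: shifted_value_ge0.
have J1 : (\int[lam]_(z in euc_ball y t `\` euc_ball x s) v z <=
    (2 * C * (vol lam * (t ^+ N - s ^+ N)))%:E)%E.
  apply: (@le_trans _ _ (\int[lam]_(z in euc_ball y t `\` euc_ball x s) (2 * C)%:E)%E).
    apply: ge0_le_integral => //.
    - by move=> z _; exact: shifted_value_ge0.
    - exact: measurable_funS mv.
    - by move=> z _; exact: shifted_value_le.
  by rewrite integral_cst// lamD -EFinM.
rewrite /ball_integral -!lee_fin EFinD !fineK ?If// E.
by rewrite leeDl//= leeD2l.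
Qed.

Lemma continuous_ball_integral x0 : D x0 ->
  ball_integral x (rho x) @[x --> x0] --> ball_integral x0 (rho x0).
Proof.
move=> Dx0; have B0 := bdry_nonempty hN hDo hDb Dx0.
have r0 := step_gt0 hN hDo hDb heps Dx0.
have cr : continuous rho by exact: continuous_step.
(* The balls at [x0] and [x] both contain the ball at [x0] of radius [rho x0 - d x] and lie in that
   of radius [rho x0 + d x]; [K (d x)] bounds the integral over the shell between these. *)
pose d x := euc_norm (x - x0) + `|rho x - rho x0|.
pose K (t : R) := 2 * C * (vol lam * ((rho x0 + t) ^+ N - (rho x0 - t) ^+ N)).
have cd : d x @[x --> x0] --> 0.
  have c1 : euc_norm (x - x0) @[x --> x0] --> (0 : R).
    rewrite -(@euc_norm0 R N) -(subrr x0).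
    exact: (cvg_comp _ _ (cvgB cvg_id (cvg_cst x0)) (@euc_norm_continuous R N (x0 - x0))).
  have c2 : `|rho x - rho x0| @[x --> x0] --> (0 : R).
    rewrite -(@normr0 _ R) -(subrr (rho x0)).
    exact: (cvg_norm (cvgB (cr x0) (cvg_cst (rho x0)))).
  by rewrite -[X in _ --> X]addr0; exact: (cvgD c1 c2).
have K0 : K 0 = 0 by rewrite /K addr0 subr0 subrr !mulr0.
have cK : K (d x) @[x --> x0] --> 0.
  rewrite -K0; apply: (cvg_comp _ _ cd).
  apply: cvgM; first exact: cvg_cst.
  apply: cvgM; first exact: cvg_cst.
  apply: cvgB.
    exact: (cvg_comp _ _ (cvgD (cvg_cst _) cvg_id) (@exprn_continuous R N _)).
  exact: (cvg_comp _ _ (cvgB (cvg_cst _) cvg_id) (@exprn_continuous R N _)).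
have key x : d x < rho x0 -> D x ->
    `|ball_integral x0 (rho x0) - ball_integral x (rho x)| <= K (d x).
  move=> dx Dx; have rx := step_gt0 hN hDo hDb heps Dx.
  have d0 : 0 <= d x by rewrite addr_ge0 ?euc_norm_ge0.
  have nx := @euc_norm_ge0 R N (x - x0).
  have s0 : 0 < rho x0 - d x by rewrite subr_gt0.
  have t0 : 0 < rho x0 + d x by lra.
  (* A reflexive inequality, split by [ler_norml] into two one-sided bounds. *)
  have : `|rho x - rho x0| <= `|rho x - rho x0| by [].
  rewrite ler_norml => /andP[rx1 rx2].
  have i1 : euc_ball x0 (rho x0 - d x) `<=` euc_ball x (rho x).
    move=> y; rewrite /euc_ball/= => yx0; apply: (le_lt_trans (euc_dist_triangle y x0 x)).
    by rewrite (euc_distC x0 x); move: yx0 rx1; rewrite /d; lra.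
  have i2 : euc_ball x (rho x) `<=` euc_ball x0 (rho x0 + d x).
    move=> y; rewrite /euc_ball/= => yx; apply: (le_lt_trans (euc_dist_triangle y x x0)).
    by move: yx rx2; rewrite /d; lra.
  have i3 : euc_ball x0 (rho x0 - d x) `<=` euc_ball x0 (rho x0).
    by move=> y; rewrite /euc_ball/= => /lt_le_trans; apply; lra.
  have i4 : euc_ball x0 (rho x0) `<=` euc_ball x0 (rho x0 + d x).
    by move=> y; rewrite /euc_ball/= => /lt_le_trans; apply; lra.
  have /andP[a1 _] := le_ball_integral B0 s0 rx i1.
  have /andP[a2 _] := le_ball_integral B0 rx t0 i2.
  have /andP[a3 _] := le_ball_integral B0 s0 r0 i3.
  have /andP[a4 _] := le_ball_integral B0 r0 t0 i4.
  have /andP[_ a5] := le_ball_integral B0 s0 t0 (subset_trans i3 i4).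
  have b1 : ball_integral x0 (rho x0 - d x) <= ball_integral x0 (rho x0) <=
      ball_integral x0 (rho x0 + d x).
    by rewrite a3 a4.
  have b2 : ball_integral x0 (rho x0 - d x) <= ball_integral x (rho x) <=
      ball_integral x0 (rho x0 + d x).
    by rewrite a1 a2.
  exact: (dist_le_sandwich b1 b2 a5).
have lim e : 0 < e -> \forall x \near (x0 : 'rV[R]_N),
    `|ball_integral x0 (rho x0) - ball_integral x (rho x)| < e.
  move=> e0.
  have n1 : \forall x \near (x0 : 'rV[R]_N), d x < rho x0 by exact: (cvgr_lt _ cd).
  have n2 : \forall x \near (x0 : 'rV[R]_N), K (d x) < e by exact: (cvgr_lt _ cK).
  have n3 : \forall x \near (x0 : 'rV[R]_N), D x by exact: open_nbhs_nbhs.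
  by move: n1 n2 n3; apply: filterS3 => x dx Kx Dx; exact: le_lt_trans (key x dx Dx) Kx.
by move/cvgrPdist_lt: lim.
Qed.

(** By the mean value property the value is on [D] a quotient of continuous functions minus [C]; as
    [D] is open, this identity holds near [x0]. *)
Lemma u_eps_continuous x0 : D x0 -> {for x0, continuous (u_eps P D F eps)}.
Proof.
move=> Dx0; have B0 := bdry_nonempty hN hDo hDb Dx0.
have v0 : 0 < vol lam by apply: vol_gt0.
pose g x := ball_integral x (rho x) / (rho x ^+ N * vol lam) - C.
have gE x : D x -> u_eps P D F eps x = g x.
  move=> Dx; have r0 := step_gt0 hN hDo hDb heps Dx.
  rewrite u_epsE// /g /ball_integral shifted_value_mean// fineM ?shifted_value_fin//=.
  by rewrite mulrAC mulfV ?mul1r// gt_eqF// mulr_gt0// exprn_gt0.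
have cg : g x @[x --> x0] --> g x0.
  have cr : rho x ^+ N @[x --> x0] --> rho x0 ^+ N.
    have cs : {for x0, continuous rho} by exact: continuous_step.
    exact: (cvg_comp _ _ cs (@exprn_continuous R N (rho x0))).
  have r0 := step_gt0 hN hDo hDb heps Dx0.
  have ne : rho x0 ^+ N * vol lam != 0 by rewrite gt_eqF// mulr_gt0// exprn_gt0.
  exact: (cvgB (cvgM (continuous_ball_integral Dx0)
    (cvgV ne (cvgM cr (cvg_cst (vol lam))))) (cvg_cst C)).
rewrite /prop_for /continuous_at gE//; 
have nD : \forall x \near (x0 : 'rV[R]_N), D x by exact: open_nbhs_nbhs.
have gu : \forall x \near (x0 : 'rV[R]_N), g x = u_eps P D F eps x.
  by move: nD; apply: filterS => x /gE.
exact: (cvg_trans (near_eq_cvg gu) cg).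
Qed.

End bounded_payoff.

End value_function.

Theorem theorem2p4 (R : realType) (N : nat) (hN : (0 < N)%N)
  (lam : {measure set (RN R N) -> \bar R}) (P : probability (Omega R N) R)
  (hlam : is_lebesgue_RN lam) (hP : is_ball_product lam P)
  (D : set 'rV[R]_N) (hDo : open D) (hDb : bounded_set D) (hDc : connected D)
  (F : 'rV[R]_N -> R) (hF : {within bdry D, continuous F})
  (eps : R) (heps : 0 < eps < 1) :
  {in D, continuous (u_eps P D F eps)} /\
  forall x, D x ->
    let r := Num.min eps (euc_dist x (bdry D)) in
    u_eps P D F eps x =
      (fine (lam (euc_ball x r)))^-1 *
      fine (\int[lam]_(y in (euc_ball x r : set (RN R N))) (u_eps P D F eps y)%:E).
Proof.
have [C C0 FC] := bounded_on_bdry hDb hF; split.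
- by move=> x /set_mem Dx; exact: (u_eps_continuous hN hlam hP hDo hDb hF heps C0 FC Dx).
- move=> x Dx /=; exact: (u_eps_mean hN hlam hP hDo hDb hF heps C0 FC Dx).
Qed.
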